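(* Fix a polynomially bounded o-minimal expansion of $\mathbb{R}$. Let $\mathcal{A}$ be a definable family of subsets of $\mathbb{R}^n$ parametrized by the definable set $A$, and let $\mathcal{B}$ be a definable family of subsets of $\mathbb{R}^{n+1}$ parametrized by the definable set $B$. Then there exists $N = N(\mathcal{A},\mathcal{B}) > 0$ having the following property. For any triple of finite sets $(A',B',B'')$ with $A' \subset A$ and $B',B'' \subset B$, there exists $c \in \mathbb{R}$ (depending on this triple) such that for each closed and bounded $(\mathcal{A},A')$-set $S$, each $(\mathcal{B},B')$-set $F$ and each $(\mathcal{B},B'')$-set $G$ such that $F,G$ are graphs of definable functions $f,g:\mathbb{R}^n \rightarrow \mathbb{R}$ which are continuous on $S$ and satisfy $f|_S^{-1}(0) \subset g|_S^{-1}(0)$, we have for all $x \in S$ \[ |g(x)|^N \leq c \cdot |f(x)|. \]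
   Context: An o-minimal expansion of $\mathbb{R}$ is polynomially bounded if for every definable $h:\mathbb{R}\to\mathbb{R}$ there exist $N\in\mathbb{N}$, $c\in\mathbb{R}$ with $|h(x)|<x^N$ for all $x>c$. A definable family of subsets of $\mathbb{R}^n$ parametrized by a definable set $A$ is a definable subset $\mathcal{A}\subset A\times\mathbb{R}^n$; for $a\in A$, $\mathcal{A}_a=\{y\in\mathbb{R}^n : (a,y)\in\mathcal{A}\}$. For a finite subset $A'\subset A$, an $(\mathcal{A},A')$-set is any subset of $\mathbb{R}^n$ belonging to the Boolean algebra of subsets of $\mathbb{R}^n$ generated by the sets $\mathcal{A}_a$, $a\in A'$. *)

(* Defs.v *)
From Stdlib Require Import Reals List.
From mathcomp Require Import ssreflect ssrfun ssrbool eqtype ssrnat fintype.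

Set Implicit Arguments.
Unset Strict Implicit.

Open Scope R_scope.

Definition pt (n : nat) := 'I_n -> R.
Definition set_ (n : nat) := pt n -> Prop.

Definition om_init {n : nat} (x : pt n.+1) : pt n :=
  fun i => x (widen_ord (leqnSn n) i).
Definition om_lastc {n : nat} (x : pt n.+1) : R := x ord_max.
Definition om_tailc {n : nat} (x : pt n.+1) : pt n := fun i => x (lift ord0 i).
Definition om_snoc {n : nat} (x : pt n) (t : R) : pt n.+1 :=
  fun i => match unlift ord_max i with Some j => x j | None => t end.
Definition om_concat {m n : nat} (a : pt m) (y : pt n) : pt (m + n) :=
  fun i => match split i with inl j => a j | inr k => y k end.

Definition om_structure := forall n : nat, set_ n -> Prop.

Definition om_in_interval (iv : option R * option R) (t : R) : Prop :=
  (match fst iv with None => True | Some a => a < t end) /\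
  (match snd iv with None => True | Some b => t < b end).

(** [D] is an o-minimal expansion of the ordered field R
    (van den Dries, Tame topology and o-minimal structures, Ch. 1). *)
Record is_ominimal_expansion (D : om_structure) : Prop := {
  om_ext : forall n (X Y : set_ n), D n X -> (forall x, X x <-> Y x) -> D n Y;
  om_empty : forall n, D n (fun _ => False);
  om_union : forall n (X Y : set_ n), D n X -> D n Y -> D n (fun x => X x \/ Y x);
  om_compl : forall n (X : set_ n), D n X -> D n (fun x => ~ X x);
  om_prodR : forall n (X : set_ n), D n X -> D n.+1 (fun x => X (om_init x));
  om_Rprod : forall n (X : set_ n), D n X -> D n.+1 (fun x => X (om_tailc x));
  om_diag : forall n (i j : 'I_n), D n (fun x => x i = x j);
  om_proj : forall n (X : set_ n.+1), D n.+1 X ->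
              D n (fun x => exists t, X (om_snoc x t));
  om_lt : D 2%nat (fun x : pt 2 => x ord0 < x ord_max);
  om_add : D 3%nat (fun x : pt 3 => x (inord 0%nat) + x (inord 1%nat) = x (inord 2%nat));
  om_mul : D 3%nat (fun x : pt 3 => x (inord 0%nat) * x (inord 1%nat) = x (inord 2%nat));
  om_omin : forall X : set_ 1%nat, D 1%nat X <->
     exists (pts : list R) (ivs : list (option R * option R)),
       forall x, X x <-> (In (x ord0) pts \/
                          exists iv, In iv ivs /\ om_in_interval iv (x ord0))
}.

Definition om_graph {n : nat} (f : pt n -> R) : set_ n.+1 :=
  fun y => f (om_init y) = om_lastc y.

Definition polynomially_bounded (D : om_structure) : Prop :=
  forall h : R -> R, D 2%nat (fun x : pt 2 => h (x ord0) = x ord_max) ->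
    exists (N : nat) (c : R), forall x, c < x -> Rabs (h x) < x ^ N.

Definition definable_family (D : om_structure) (p n : nat)
  (P : set_ p) (Fam : set_ (p + n)) : Prop :=
  D p P /\ D (p + n)%nat Fam /\ (forall a y, Fam (om_concat a y) -> P a).

Definition om_fiber {p n : nat} (Fam : set_ (p + n)) (a : pt p) : set_ n :=
  fun y => Fam (om_concat a y).

Inductive boolgen {p n : nat} (Fam : set_ (p + n)) (A' : list (pt p)) :
  set_ n -> Prop :=
| bg_gen : forall a, In a A' -> boolgen Fam A' (om_fiber Fam a)
| bg_full : boolgen Fam A' (fun _ => True)
| bg_compl : forall X, boolgen Fam A' X -> boolgen Fam A' (fun y => ~ X y)
| bg_union : forall X Y, boolgen Fam A' X -> boolgen Fam A' Y ->
               boolgen Fam A' (fun y => X y \/ Y y)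
| bg_ext : forall X Y, boolgen Fam A' X -> (forall y, X y <-> Y y) ->
               boolgen Fam A' Y.

(** Topology of R^n (sup-norm, equivalent to the Euclidean one). *)
Definition om_near_pt {n : nat} (x y : pt n) (e : R) : Prop :=
  forall i, Rabs (y i - x i) < e.

Definition om_closed_set {n : nat} (S : set_ n) : Prop :=
  forall x, ~ S x -> exists e, 0 < e /\ forall y, om_near_pt x y e -> ~ S y.

Definition om_bounded_set {n : nat} (S : set_ n) : Prop :=
  exists M, forall x, S x -> forall i, Rabs (x i) <= M.

Definition om_continuous_on {n : nat} (f : pt n -> R) (S : set_ n) : Prop :=
  forall x, S x -> forall e, 0 < e ->
    exists d, 0 < d /\ forall y, S y -> om_near_pt x y d -> Rabs (f y - f x) < e.

(* Main.v *)
Require Import Defs.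
From Stdlib Require Import Reals List Lra Lia ZArith.
From Stdlib Require Import Classical ClassicalEpsilon FunctionalExtensionality PropExtensionality.
From mathcomp Require Import ssreflect ssrfun ssrbool eqtype ssrnat seq choice fintype.
Open Scope R_scope.

Set Implicit Arguments.
Unset Strict Implicit.
Unset Printing Implicit Defensive.

(** The exponent is controlled by a definable family of one-variable functions that does
    not depend on the finite sets of parameters.

    Sample points: for a definable family there are finite sets, definable from a bounded
    number of its parameters, which meet every nonempty Boolean combination of members of
    the family.  The proof is by induction on the dimension: as the first coordinate [t]
    moves, the finite set sampling the fibre over [t] varies continuously and stays on the
    same side of a given member, except for finitely many [t].  That finiteness is a
    countability argument specific to R: an interval covered by countably many definable
    sets has a subinterval contained in one of them.  So the projection to [t] of a Boolean
    combination can change only at points of finite sets in a family with a bounded number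
    of parameters.

    Applied to the possible values of [|f|] on [S] under the constraint [|g| >= v], this
    shows that their infimum lies in a finite set [Z_q(v)], hence is at least the least
    positive element of [Z_q(v)].

    Uniform growth: in a definable family [h_q] of positive nondecreasing functions, the
    numbers [m] with [h_q(2t) >= m h_q(t)] eventually are bounded; otherwise comparing
    [h_q(st)] with [h_q(t)] would define a function above [s^(log2 s)], against polynomial
    boundedness.  This gives one exponent [N] for [v] small; for [v] bounded away from 0
    compactness gives the constant. *)

(** * Spaces with real coordinates *)

(** A type with a bijection onto some [pt n]. Only the carrier serves as a key for canonical
    structures, so formulas can be written with pairs and projections while their coordinates are
    found by unification. *)
Record rspace := RSpace {
  rcar :> Type;
  #[canonical=no] rdim : nat;
  #[canonical=no] renc : rcar -> pt rdim;
  #[canonical=no] rdec : pt rdim -> rcar;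
  #[canonical=no] rencK : forall x, rdec (renc x) = x;
  #[canonical=no] rdecK : forall x, renc (rdec x) = x }.

Canonical R_sp : rspace.
Proof.
refine (@RSpace R 1 (fun t _ => t) (fun x => x ord0) _ _) => //.
by move=> x; apply: functional_extensionality => i; rewrite (ord1 i).
Defined.

Canonical unit_sp : rspace.
Proof.
refine (@RSpace unit 0 (fun _ _ => 0) (fun _ => tt) _ _); first by case.
by move=> x; apply: functional_extensionality => -[].
Defined.

Canonical pt_sp (n : nat) : rspace :=
  @RSpace (pt n) n id id (fun _ => erefl) (fun _ => erefl).

Lemma om_concat_l m n (x : pt m) (y : pt n) i :
  om_concat x y (lshift n i) = x i.
Proof. by rewrite /om_concat (unsplitK (inl i)). Qed.

Lemma om_concat_r m n (x : pt m) (y : pt n) i :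
  om_concat x y (rshift m i) = y i.
Proof. by rewrite /om_concat (unsplitK (inr i)). Qed.

Lemma om_concat_eta m n (z : pt (m + n)) :
  om_concat (fun i => z (lshift n i)) (fun j => z (rshift m j)) = z.
Proof.
apply: functional_extensionality => i.
by rewrite -[in RHS](splitK i) /om_concat; case: (split i).
Qed.

Canonical prod_sp (T1 T2 : rspace) : rspace.
Proof.
refine (@RSpace (T1 * T2)%type (rdim T1 + rdim T2)
  (fun x => om_concat (renc x.1) (renc x.2))
  (fun z => (rdec (fun i => z (lshift _ i)), rdec (fun j => z (rshift _ j)))) _ _).
- move=> [x y] /=; congr (_, _); rewrite -[RHS]rencK; congr rdec;
  apply: functional_extensionality => i; by rewrite ?om_concat_l ?om_concat_r.
- by move=> z /=; rewrite !rdecK om_concat_eta.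
Defined.

(** * Closure of definable sets and maps under first-order operations *)

Section Definability.

Variable D : om_structure.
Hypothesis HD : is_ominimal_expansion D.

Lemma D_ext n (X Y : set_ n) : D X -> (forall x, X x <-> Y x) -> D Y.
Proof. exact: (om_ext HD). Qed.

Lemma D_and n (X Y : set_ n) : D X -> D Y -> D (fun x => X x /\ Y x).
Proof.
move=> hX hY.
apply: (D_ext (om_compl HD (om_union HD (om_compl HD hX) (om_compl HD hY)))) => x.
by split; [move=> h; split; apply: NNPP; tauto | tauto].
Qed.

Lemma D_true n : D (fun _ : pt n => True).
Proof. by apply: (D_ext (om_compl HD (om_empty HD n))) => x; tauto. Qed.

Lemma D_forall_in n k (X : 'I_k -> set_ n) :
  (forall j, D (X j)) -> D (fun x => forall j, X j x).
Proof.
move=> hX.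
have H (l : seq 'I_k) : D (fun x => forall j, j \in l -> X j x).
  elim: l => [|a l IH]; first by apply: (D_ext (D_true n)).
  apply: (D_ext (D_and (hX a) IH)) => x; split.
    by move=> [h1 h2] j; rewrite inE => /orP[/eqP->|]; [|apply: h2].
  by move=> h; split=> [|j hj]; apply: h; rewrite inE ?eqxx ?hj ?orbT.
apply: (D_ext (H (enum 'I_k))) => x.
by split=> h j; [apply: h; rewrite mem_enum | move=> _; apply: h].
Qed.

Lemma D_shift m n (X : set_ n) : D X -> D (fun z : pt (m + n) => X (fun j => z (rshift m j))).
Proof.
move=> hX; elim: m => [|m IH].
  apply: (D_ext hX) => x; suff -> : (fun j => x (rshift 0 j)) = x by [].
  by apply: functional_extensionality => j; congr (x _); apply: val_inj.
apply: (D_ext (om_Rprod HD IH)) => x; rewrite /om_tailc.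
suff -> : (fun j => x (lift ord0 (rshift m j))) = (fun j => x (rshift m.+1 j)) by [].
by apply: functional_extensionality => j; congr (x _); apply: val_inj.
Qed.

Lemma D_cast m n (e : m = n) (X : set_ m) :
  D X -> D (fun x : pt n => X (fun i => x (cast_ord e i))).
Proof.
case: n / e => hX; apply: (D_ext hX) => x.
suff -> : (fun i => x (cast_ord erefl i)) = x by [].
by apply: functional_extensionality => i; rewrite cast_ord_id.
Qed.

(** Iterates [om_proj], which drops the last coordinate. The dimension is written [n + m] because
    [n.+1 + m] computes to a successor, so that [om_proj] applies without a cast. *)
Lemma D_proj_iter n m (Z : set_ (n + m)) : D Z ->
  D (fun x : pt m => exists z, Z z /\ forall i, z (widen_ord (leq_addl n m) i) = x i).
Proof.
elim: n Z => [|n IH] Z hZ.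
  apply: (D_ext hZ) => x; split.
    by move=> h; exists x; split=> // i; congr (x _); apply: val_inj.
  move=> [z [h e]]; suff <- : z = x by [].
  by apply: functional_extensionality => i; rewrite -e; congr (z _); apply: val_inj.
apply: (D_ext (IH _ (om_proj HD hZ))) => x; split.
- move=> [z [[t h] e]]; exists (om_snoc z t); split=> // i.
  rewrite -e /om_snoc; case: unliftP => [j|] hj.
    by congr (z _); apply: val_inj; move/(congr1 val): hj; rewrite /= /bump leqNgt ltn_ord.
  by move/(congr1 val): hj => /= hj; have := leq_trans (ltn_ord i) (leq_addl n m); rewrite hj ltnn.
- move=> [z [h e]]; exists (om_init z); split.
    exists (om_lastc z); suff -> : om_snoc (om_init z) (om_lastc z) = z by [].
    apply: functional_extensionality => i; rewrite /om_snoc /om_init /om_lastc.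
    case: unliftP => [j ->|-> //]; congr (z _); apply: val_inj.
    by rewrite /= /bump leqNgt ltn_ord.
  by move=> i; rewrite /om_init -e; congr (z _); apply: val_inj.
Qed.

Lemma D_exists_concat m n (Z : set_ (m + n)) :
  D Z -> D (fun x : pt m => exists y : pt n, Z (om_concat x y)).
Proof.
move=> hZ; apply: (D_ext (D_proj_iter (D_cast (addnC m n) hZ))) => x; split.
- move=> [z [h e]].
  exists (fun j => z (cast_ord (addnC m n) (rshift m j))).
  move: h; suff -> : (fun i => z (cast_ord (addnC m n) i)) =
     om_concat x (fun j => z (cast_ord (addnC m n) (rshift m j))) by [].
  rewrite -[LHS]om_concat_eta; congr om_concat; apply: functional_extensionality => i.
  by rewrite -e; congr (z _); apply: val_inj.
- move=> [y h]; exists (fun i => om_concat x y (cast_ord (addnC n m) i)); split.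
    suff -> : (fun i => om_concat x y (cast_ord (addnC n m) (cast_ord (addnC m n) i)))
      = om_concat x y by [].
    by apply: functional_extensionality => i; congr om_concat; apply: val_inj.
  by move=> i; rewrite -[RHS](om_concat_l x y); congr om_concat; apply: val_inj.
Qed.

(** Works for any [s], injective or not: add variables [y] in [X], impose the diagonal equations
    [y_j = x_(s j)], and project [y] away. *)
Lemma D_coord m n (s : 'I_n -> 'I_m) (X : set_ n) :
  D X -> D (fun x : pt m => X (fun j => x (s j))).
Proof.
move=> hX.
have hd : D (fun z : pt (m + n) => forall j : 'I_n, z (rshift m j) = z (lshift n (s j))).
  by apply: D_forall_in => j; apply: (om_diag HD).
apply: (D_ext (D_exists_concat (D_and (D_shift m hX) hd))) => x; split.
- move=> [y [h e]]; move: h.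
  suff -> : (fun j => om_concat x y (rshift m j)) = (fun j => x (s j)) by [].
  by apply: functional_extensionality => j; rewrite e om_concat_l.
- move=> h; exists (fun j => x (s j)); split.
    suff -> : (fun j => om_concat x (fun j => x (s j)) (rshift m j)) = (fun j => x (s j)) by [].
    by apply: functional_extensionality => j; rewrite om_concat_r.
  by move=> j; rewrite om_concat_r om_concat_l.
Qed.

Definition Def (T : rspace) (X : T -> Prop) : Prop := D (fun x => X (rdec x)).

Definition DefM (G T : rspace) (f : G -> T) : Prop :=
  Def (fun z : prod_sp G T => f z.1 = z.2).

Lemma Def_ext (T : rspace) (X Y : T -> Prop) :
  Def X -> (forall x, X x <-> Y x) -> Def Y.
Proof. by move=> hX e; apply: (D_ext hX). Qed.

Lemma Def_and (T : rspace) (X Y : T -> Prop) : Def X -> Def Y -> Def (fun x => X x /\ Y x).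
Proof. exact: D_and. Qed.

Lemma Def_or (T : rspace) (X Y : T -> Prop) : Def X -> Def Y -> Def (fun x => X x \/ Y x).
Proof. exact: (om_union HD). Qed.

Lemma Def_not (T : rspace) (X : T -> Prop) : Def X -> Def (fun x => ~ X x).
Proof. exact: (om_compl HD). Qed.

Lemma Def_imp (T : rspace) (X Y : T -> Prop) : Def X -> Def Y -> Def (fun x => X x -> Y x).
Proof.
move=> hX hY; apply: (Def_ext (Def_or (Def_not hX) hY)) => x; split; first tauto.
by move=> h; case: (classic (X x)); tauto.
Qed.

Lemma Def_iff (T : rspace) (X Y : T -> Prop) : Def X -> Def Y -> Def (fun x => X x <-> Y x).
Proof. by move=> hX hY; apply: Def_and; apply: Def_imp. Qed.

Lemma Def_const (T : rspace) (P : Prop) : Def (fun _ : T => P).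
Proof.
case: (classic P) => h.
  by apply: (D_ext (D_true _)).
by apply: (D_ext (om_empty HD _)).
Qed.

Lemma Def_ex (G T : rspace) (Q : G -> T -> Prop) :
  Def (fun z : prod_sp G T => Q z.1 z.2) -> Def (fun x => exists t, Q x t).
Proof.
move=> h; apply: (D_ext (D_exists_concat h)) => x /=; split.
- move=> [y]; set u := (fun i : 'I_(rdim G) => _); have -> : u = x.
    by apply: functional_extensionality => i; rewrite /u om_concat_l.
  by move=> h1; eexists; exact: h1.
- move=> [t h1]; exists (renc t).
  set u := (fun i : 'I_(rdim G) => _); have -> : u = x.
    by apply: functional_extensionality => i; rewrite /u om_concat_l.
  set v := (fun i : 'I_(rdim T) => _); have -> : v = renc t.
    by apply: functional_extensionality => i; rewrite /v om_concat_r.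
  by rewrite rencK.
Qed.

Lemma Def_all (G T : rspace) (Q : G -> T -> Prop) :
  Def (fun z : prod_sp G T => Q z.1 z.2) -> Def (fun x => forall t, Q x t).
Proof.
move=> h; apply: (Def_ext (Def_not (@Def_ex G T (fun x t => ~ Q x t) (Def_not h)))) => x; split.
- by move=> h1 t; apply: NNPP => h2; apply: h1; exists t.
- by move=> h1 [t h2]; exact: (h2 (h1 t)).
Qed.

(** Maps that permute, repeat or drop coordinates. Their preimages come straight from [D_coord],
    without graphs, and this starts off the calculus of definable maps. *)
Definition coord_map (G T : rspace) (f : G -> T) : Prop :=
  exists s : 'I_(rdim T) -> 'I_(rdim G), forall x j, renc (f x) j = renc x (s j).

Lemma Def_coord (G T : rspace) (f : G -> T) (X : T -> Prop) :
  coord_map f -> Def X -> Def (fun x => X (f x)).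
Proof.
move=> [s e] hX; apply: (D_ext (D_coord s hX)) => x.
suff -> : rdec (fun j => x (s j)) = f (rdec x) by [].
rewrite -[RHS]rencK; congr rdec; apply: functional_extensionality => j.
by rewrite e rdecK.
Qed.

Lemma coord_id (G : rspace) : coord_map (fun x : G => x).
Proof. by exists id. Qed.

Lemma coord_fst (G T1 T2 : rspace) (f : G -> prod_sp T1 T2) :
  coord_map f -> coord_map (fun x => (f x).1).
Proof.
move=> [s e]; exists (fun j => s (lshift _ j)) => x j.
by rewrite -e /= om_concat_l.
Qed.

Lemma coord_snd (G T1 T2 : rspace) (f : G -> prod_sp T1 T2) :
  coord_map f -> coord_map (fun x => (f x).2).
Proof.
move=> [s e]; exists (fun j => s (rshift _ j)) => x j.
by rewrite -e /= om_concat_r.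
Qed.

Lemma coord_pair (G T1 T2 : rspace) (f : G -> T1) (g : G -> T2) :
  coord_map f -> coord_map g -> coord_map (fun x => (f x, g x) : prod_sp T1 T2).
Proof.
move=> [s e] [s' e'].
exists (fun i => match split i with inl j => s j | inr k => s' k end) => x i /=.
by rewrite /om_concat; case: (split i) => j.
Qed.

Ltac coords := cbv beta; lazymatch goal with
  | |- coord_map (fun x => x) => apply coord_id
  | |- coord_map (fun x => (@?f x, @?g x)) => apply (@coord_pair _ _ _ f g); coords
  | |- coord_map (fun x => fst (@?f x)) => apply (@coord_fst _ _ _ f); coords
  | |- coord_map (fun x => snd (@?f x)) => apply (@coord_snd _ _ _ f); coords
  end.

Lemma Def_eq_coord (G T : rspace) (f g : G -> T) :
  coord_map f -> coord_map g -> Def (fun x => f x = g x).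
Proof.
move=> [s e] [s' e'].
have h : D (fun x : pt (rdim G) => forall j, x (s j) = x (s' j)).
  by apply: D_forall_in => j; apply: (om_diag HD).
apply: (D_ext h) => x; split.
- move=> h1; rewrite -[LHS]rencK -[RHS]rencK; congr rdec.
  by apply: functional_extensionality => j; rewrite e e' rdecK.
- by move=> h1 j; move: (e (rdec x) j) (e' (rdec x) j); rewrite h1 rdecK => <- <-.
Qed.

Lemma DefM_coord (G T : rspace) (f : G -> T) : coord_map f -> DefM f.
Proof.
move=> [s e]; rewrite /DefM.
apply: (@Def_eq_coord (prod_sp G T) T (fun z => f z.1) (fun z => z.2)); last by coords.
by exists (fun j => lshift _ (s j)) => x j; rewrite e /= om_concat_l.
Qed.

Lemma Def_preimage (G T : rspace) (X : T -> Prop) (f : G -> T) :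
  Def X -> DefM f -> Def (fun x => X (f x)).
Proof.
move=> hX hf.
have h : Def (fun x : G => exists t, f x = t /\ X t).
  by apply: Def_ex; apply: Def_and => //; apply: (@Def_coord _ _ (fun z => z.2)) hX; coords.
by apply: (Def_ext h) => x; split=> [[t [<-]]|hx] //; exists (f x).
Qed.

Lemma DefM_comp (G T V : rspace) (g : T -> V) (f : G -> T) :
  DefM g -> DefM f -> DefM (fun x => g (f x)).
Proof.
move=> hg hf; rewrite /DefM.
have h : Def (fun z : prod_sp G V => exists t, f z.1 = t /\ g t = z.2).
  apply: Def_ex; apply: Def_and.
    by apply: (@Def_coord _ _ (fun w : prod_sp (prod_sp G V) T => (w.1.1, w.2)) _ _ hf); coords.
  by apply: (@Def_coord _ _ (fun w : prod_sp (prod_sp G V) T => (w.2, w.1.2)) _ _ hg); coords.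
by apply: (Def_ext h) => z; split=> [[t [<-]]|hz] //; exists (f z.1).
Qed.

Lemma DefM_id (G : rspace) : DefM (fun x : G => x).
Proof. by apply: DefM_coord; coords. Qed.

Lemma DefM_fst (G T1 T2 : rspace) (f : G -> prod_sp T1 T2) :
  DefM f -> DefM (fun x => (f x).1).
Proof.
move=> h; apply: (@DefM_comp _ _ _ (fun w : prod_sp T1 T2 => w.1)) h.
by apply: DefM_coord; coords.
Qed.

Lemma DefM_snd (G T1 T2 : rspace) (f : G -> prod_sp T1 T2) :
  DefM f -> DefM (fun x => (f x).2).
Proof.
move=> h; apply: (@DefM_comp _ _ _ (fun w : prod_sp T1 T2 => w.2)) h.
by apply: DefM_coord; coords.
Qed.

Lemma DefM_pair (G T1 T2 : rspace) (f : G -> T1) (g : G -> T2) :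
  DefM f -> DefM g -> DefM (fun x => (f x, g x) : prod_sp T1 T2).
Proof.
move=> hf hg; rewrite /DefM.
have h : Def (fun z : prod_sp G (prod_sp T1 T2) => f z.1 = z.2.1 /\ g z.1 = z.2.2).
  apply: Def_and.
    by apply: (@Def_coord _ _ (fun w : prod_sp G (prod_sp T1 T2) => (w.1, w.2.1)) _ _ hf); coords.
  by apply: (@Def_coord _ _ (fun w : prod_sp G (prod_sp T1 T2) => (w.1, w.2.2)) _ _ hg); coords.
by apply: (Def_ext h) => -[x [y1 y2]] /=; split=> [[-> ->]|[-> ->]].
Qed.

(** The o-minimality axiom is an equivalence, so every real singleton is definable: formulas may use
    arbitrary real constants. *)
Lemma Def_point (c : R) : Def (fun x : R_sp => x = c).
Proof.
have h := proj2 (om_omin HD (fun x => x ord0 = c)).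
apply: h; exists [:: c], [::] => x; split=> [->|]; first by left; left.
by case=> [[->|[]]|[iv [[]]]].
Qed.

Lemma DefM_const (G T : rspace) (c : T) : DefM (fun _ : G => c).
Proof.
rewrite /DefM.
have h : D (fun x : pt (rdim (prod_sp G T)) =>
    forall j, x (rshift (rdim G) j) = renc c j).
  apply: D_forall_in => j.
  exact: (D_coord (fun _ : 'I_1 => rshift (rdim G) j) (Def_point (renc c j))).
apply: (D_ext h) => x /=; split.
- move=> e; rewrite -[LHS]rencK; congr rdec; apply: functional_extensionality => j.
  by rewrite e.
- by move=> -> j; rewrite rdecK.
Qed.

Lemma Def_ltR : Def (fun z : prod_sp R_sp R_sp => z.1 < z.2).
Proof.
apply: (D_ext (D_coord (fun i : 'I_2 => i) (om_lt HD))) => x /=.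
have <- : @lshift 1 1 ord0 = ord0 by apply: val_inj.
by have <- : @rshift 1 1 ord0 = ord_max by apply: val_inj.
Qed.

Lemma Def_ternary (op : R -> R -> R) :
  D (fun x : pt 3 => op (x (inord 0)) (x (inord 1)) = x (inord 2)) ->
  DefM (fun z : prod_sp R_sp R_sp => op z.1 z.2).
Proof.
move=> h; apply: (D_ext h) => x /=.
have <- : @lshift 2 1 (@lshift 1 1 ord0) = inord 0 by apply: val_inj; rewrite /= inordK.
have <- : @lshift 2 1 (@rshift 1 1 ord0) = inord 1 by apply: val_inj; rewrite /= inordK.
by have <- : @rshift 2 1 ord0 = inord 2 by apply: val_inj; rewrite /= inordK.
Qed.

Lemma DefM_add (G : rspace) (f g : G -> R) :
  DefM (f : G -> R_sp) -> DefM (g : G -> R_sp) -> DefM ((fun x => f x + g x) : G -> R_sp).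
Proof.
move=> hf hg; apply: (@DefM_comp _ _ R_sp _ (fun x => (f x, g x) : prod_sp R_sp R_sp)
  (Def_ternary (om_add HD))).
exact: DefM_pair.
Qed.

Lemma DefM_mul (G : rspace) (f g : G -> R) :
  DefM (f : G -> R_sp) -> DefM (g : G -> R_sp) -> DefM ((fun x => f x * g x) : G -> R_sp).
Proof.
move=> hf hg; apply: (@DefM_comp _ _ R_sp _ (fun x => (f x, g x) : prod_sp R_sp R_sp)
  (Def_ternary (om_mul HD))).
exact: DefM_pair.
Qed.

Lemma DefM_ext (G T : rspace) (f g : G -> T) : DefM f -> (forall x, f x = g x) -> DefM g.
Proof. by move=> h e; apply: (Def_ext h) => x; rewrite e. Qed.

Lemma DefM_opp (G : rspace) (f : G -> R) :
  DefM (f : G -> R_sp) -> DefM ((fun x => - f x) : G -> R_sp).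
Proof.
move=> hf; apply: (DefM_ext (DefM_mul (DefM_const G (-1 : R_sp)) hf)) => x /=; lra.
Qed.

Lemma DefM_minus (G : rspace) (f g : G -> R) :
  DefM (f : G -> R_sp) -> DefM (g : G -> R_sp) -> DefM ((fun x => f x - g x) : G -> R_sp).
Proof. by move=> hf hg; exact: (DefM_add hf (DefM_opp hg)). Qed.

Lemma Def_lt (G : rspace) (f g : G -> R) :
  DefM (f : G -> R_sp) -> DefM (g : G -> R_sp) -> Def (fun x => f x < g x).
Proof.
move=> hf hg; apply: (@Def_preimage _ _ _ (fun x => (f x, g x) : prod_sp R_sp R_sp) Def_ltR).
exact: DefM_pair.
Qed.

Lemma Def_le (G : rspace) (f g : G -> R) :
  DefM (f : G -> R_sp) -> DefM (g : G -> R_sp) -> Def (fun x => f x <= g x).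
Proof.
move=> hf hg; apply: (Def_ext (Def_not (Def_lt hg hf))) => x; split; lra.
Qed.

Lemma Def_eq (G T : rspace) (f g : G -> T) :
  DefM f -> DefM g -> Def (fun x => f x = g x).
Proof.
move=> hf hg; apply: (@Def_preimage _ _ (fun z : prod_sp T T => z.1 = z.2)
  (fun x => (f x, g x) : prod_sp T T)).
  by apply: (@Def_eq_coord (prod_sp T T) T (fun z => z.1) (fun z => z.2)); coords.
exact: DefM_pair.
Qed.

Lemma DefM_abs (G : rspace) (f : G -> R) :
  DefM (f : G -> R_sp) -> DefM ((fun x => Rabs (f x)) : G -> R_sp).
Proof.
move=> hf.
have hf1 : DefM ((fun z => f z.1) : prod_sp G R_sp -> R_sp).
  by apply: DefM_comp hf _; apply: DefM_fst; exact: DefM_id.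
have h2 : DefM ((fun z => z.2) : prod_sp G R_sp -> R_sp).
  by apply: DefM_snd; exact: DefM_id.
have h0 := DefM_const (prod_sp G R_sp) (0 : R_sp).
have h : Def (fun z : prod_sp G R_sp => (0 <= f z.1 /\ f z.1 = z.2) \/ (f z.1 < 0 /\ - f z.1 = z.2)).
  apply: Def_or; apply: Def_and.
  - exact: Def_le.
  - exact: Def_eq.
  - exact: Def_lt.
  - by apply: Def_eq h2; apply: DefM_opp.
apply: (Def_ext h) => z; split.
- by move=> [[? <-]|[? <-]]; [rewrite Rabs_right; lra|rewrite Rabs_left].
- move=> <-; case: (Rle_lt_dec 0 (f z.1)) => hz; [left|right]; split=> //.
    by rewrite Rabs_right; lra.
  by rewrite Rabs_left.
Qed.

End Definability.

(** Proves definability by recursion on the syntax of a formula, a quantifier adding a factor to the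
    ambient space. Definable predicates and maps that are variables are looked up in the context;
    whatever is not recognised is left as a goal. *)
Ltac definable HD := cbv beta; lazymatch goal with
  | |- Def _ (fun x => @?P x /\ @?Q x) => apply (Def_and HD (X := P) (Y := Q)); definable HD
  | |- Def _ (fun x => @?P x \/ @?Q x) => apply (Def_or HD (X := P) (Y := Q)); definable HD
  | |- Def _ (fun x => @?P x <-> @?Q x) => apply (Def_iff HD (X := P) (Y := Q)); definable HD
  | |- Def _ (fun x => ~ @?P x) => apply (Def_not HD (X := P)); definable HD
  | |- Def _ (fun x => @?P x -> @?Q x) => apply (Def_imp HD (X := P) (Y := Q)); definable HD
  | |- Def _ (fun x => exists t, @?Q x t) => refine (Def_ex HD (Q := Q) _); definable HD
  | |- Def _ (fun x => forall t, @?Q x t) => refine (Def_all HD (Q := Q) _); definable HD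
  | |- Def _ (fun _ => ?P) => apply (Def_const HD)
  | |- Def _ (fun x => @?f x < @?g x) => apply (Def_lt HD (f := f) (g := g)); definable HD
  | |- Def _ (fun x => @?f x > @?g x) => apply (Def_lt HD (f := g) (g := f)); definable HD
  | |- Def _ (fun x => @?f x <= @?g x) => apply (Def_le HD (f := f) (g := g)); definable HD
  | |- Def _ (fun x => @?f x >= @?g x) => apply (Def_le HD (f := g) (g := f)); definable HD
  | |- Def _ (fun x => @?f x = @?g x) => refine (Def_eq HD (f := f) (g := g) _ _); definable HD
  | |- Def _ (fun x => ?X (@?f x)) =>
      refine (Def_preimage HD (X := X) (f := f) _ _); [try assumption | definable HD]
  | |- DefM _ (fun x => x) => apply (DefM_id HD)
  | |- DefM _ (fun _ => ?c) => apply (DefM_const HD)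
  | |- DefM _ (fun x => (@?f x, @?g x)) => refine (DefM_pair HD (f := f) (g := g) _ _); definable HD
  | |- DefM _ (fun x => fst (@?f x)) => refine (DefM_fst HD (f := f) _); definable HD
  | |- DefM _ (fun x => snd (@?f x)) => refine (DefM_snd HD (f := f) _); definable HD
  | |- DefM _ (fun x => @?f x + @?g x) => apply (DefM_add HD (f := f) (g := g)); definable HD
  | |- DefM _ (fun x => @?f x - @?g x) => apply (DefM_minus HD (f := f) (g := g)); definable HD
  | |- DefM _ (fun x => @?f x * @?g x) => apply (DefM_mul HD (f := f) (g := g)); definable HD
  | |- DefM _ (fun x => - @?f x) => apply (DefM_opp HD (f := f)); definable HD
  | |- DefM _ (fun x => Rabs (@?f x)) => apply (DefM_abs HD (f := f)); definable HD
  | |- DefM _ (fun x => ?g (@?f x)) =>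
      refine (DefM_comp HD (g := g) (f := f) _ _); [try assumption | definable HD]
  | |- _ => idtac
  end.

(** * Definable subsets of the line *)

Lemma list_ub (l : list R) : exists M, forall t, In t l -> t <= M.
Proof.
elim: l => [|a l [M h]]; first by exists 0.
exists (Rmax a M) => t /= [->|/h ht]; first exact: Rmax_l.
exact: Rle_trans ht (Rmax_r _ _).
Qed.

Lemma interval_open iv t : om_in_interval iv t ->
  exists a b, a < t < b /\ forall s, a < s < b -> om_in_interval iv s.
Proof.
case: iv => -[a|] [b|] [/= h1 h2].
- by exists a, b; split=> // s [h3 h4].
- by exists a, (t + 1); split; [lra|move=> s [h3 h4]; split].
- by exists (t - 1), b; split; [lra|move=> s [h3 h4]; split].
- by exists (t - 1), (t + 1); split; [lra|move=> s [h3 h4]; split].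
Qed.

(** Cantor's nested intervals: the n-th step passes to a closed third that misses [u n]. *)
Lemma interval_uncountable (u : nat -> R) a b : a < b ->
  exists t, a < t < b /\ forall n, t <> u n.
Proof.
move=> ab.
(* The outer third kept lies strictly beyond the midpoint, on the side away from [x]. The sequence
   starts at the middle third of the interval, so the limit is strictly between [a] and [b]. *)
pose step (I : R * R) x := if Rle_dec x ((I.1 + I.2) / 2)
   then ((I.1 + 2 * I.2) / 3, I.2) else (I.1, (2 * I.1 + I.2) / 3).
pose fix I n := match n with
  | 0%N => ((2 * a + b) / 3, (a + 2 * b) / 3) | k.+1 => step (I k) (u k) end.
have Ilt n : (I n).1 < (I n).2.
  elim: n => [|n IH] /=; first lra.
  by rewrite /step; case: Rle_dec => _ /=; lra.
have Imono n : (I n).1 <= (I n.+1).1 /\ (I n.+1).2 <= (I n).2.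
  by move: (Ilt n) => /=; rewrite /step; case: Rle_dec => _ /=; lra.
have Imono' n k : (I n).1 <= (I (k + n)%N).1 /\ (I (k + n)%N).2 <= (I n).2.
  elim: k => [|k [h1 h2]]; first by rewrite add0n; lra.
  by move: (Imono (k + n)%N); rewrite addSn; lra.
have Ix n k : (I n).1 <= (I k).2.
  move: (Imono' n k) (Imono' k n) (Ilt (n + k)%N); rewrite [(k + n)%N]addnC; lra.
case: (completeness (fun x => exists n, x = (I n).1)).
- by exists (I 0%N).2 => x [n ->]; apply: Ix.
- by exists (I 0%N).1, 0%N.
move=> t [h1 h2].
have ht n : (I n).1 <= t <= (I n).2.
  by split; [apply: h1; exists n | apply: h2 => x [k ->]; apply: Ix].
exists t; split; first by move: (ht 0%N) => /=; lra.
move=> n e; move: (ht n.+1) (Ilt n) => /=; rewrite /step e.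
by case: Rle_dec => h /=; lra.
Qed.

Section Line.

Variable D : om_structure.
Hypothesis HD : is_ominimal_expansion D.

Lemma Def_line_form (X : R -> Prop) : Def D (X : R_sp -> Prop) ->
  exists pts ivs, forall t, X t <->
    (In t pts \/ exists iv, In iv ivs /\ om_in_interval iv t).
Proof.
move=> /(om_omin HD) [pts [ivs h]]; exists pts, ivs => t.
exact: (h (fun _ => t)).
Qed.

Lemma Def_line_eventually (X : R -> Prop) : Def D (X : R_sp -> Prop) ->
  exists t0, (forall t, t0 < t -> X t) \/ (forall t, t0 < t -> ~ X t).
Proof.
move=> /Def_line_form [pts [ivs h]].
have [M hM] := list_ub pts.
(* An infinite endpoint contributes a harmless 0. Beyond all finite endpoints and points, membership
   only depends on whether some interval is unbounded to the right. *)
have [M1 hM1] := list_ub (List.map (fun iv : option R * option R => odflt 0 iv.1) ivs).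
have [M2 hM2] := list_ub (List.map (fun iv : option R * option R => odflt 0 iv.2) ivs).
exists (Rmax M (Rmax M1 M2)).
have hmax t : Rmax M (Rmax M1 M2) < t -> M < t /\ M1 < t /\ M2 < t.
  by move: (Rmax_l M (Rmax M1 M2)) (Rmax_r M (Rmax M1 M2)) (Rmax_l M1 M2) (Rmax_r M1 M2); lra.
case: (classic (exists iv, In iv ivs /\ iv.2 = None)).
- move=> [[a b] [hi /= e]]; left=> t /hmax [t0 [t1 t2]]; apply/h; right.
  exists (a, b); split=> //; split=> /=; last by rewrite e.
  move: (hM1 _ (in_map (fun iv : option R * option R => odflt 0 iv.1) _ _ hi)) => /=.
  by case: a hi => //= a _; lra.
- move=> hn; right=> t /hmax [t0 [t1 t2]] /h [/hM|[[a b] [hi [_ /= hb]]]]; first lra.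
  move: (hM2 _ (in_map (fun iv : option R * option R => odflt 0 iv.2) _ _ hi)) => /=.
  case: b hi hb => /= [b _|hi]; first lra.
  by move=> _ _; apply: hn; exists (a, None).
Qed.

(** An inhabited interval in the description of [X] would contradict the hypothesis, so only the
    listed points remain. *)
Lemma Def_line_finite (X : R -> Prop) : Def D (X : R_sp -> Prop) ->
  (forall a b, a < b -> exists t, a < t < b /\ ~ X t) ->
  exists l, forall t, X t -> In t l.
Proof.
move=> /Def_line_form [pts [ivs h]] hX; exists pts => t /h [//|[iv [hi /interval_open]]].
move=> [a [b [tab hab]]]; have [|s [hs]] := hX a b; first lra.
by case; apply/h; right; exists iv; split=> //; apply: hab.
Qed.

(** Otherwise each [X k] meets the interval in a finite set, by [Def_line_finite], and the interval
    would be countable. *)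
Lemma countable_cover (X : nat -> R -> Prop) a b : a < b ->
  (forall k, Def D (X k : R_sp -> Prop)) ->
  (forall t, a < t < b -> exists k, X k t) ->
  exists k a' b', [/\ a <= a', a' < b', b' <= b & forall t, a' < t < b' -> X k t].
Proof.
move=> ab hX hc; apply: NNPP => hn.
have H k : exists l, forall t, X k t /\ a < t < b -> In t l.
  apply: Def_line_finite; first by move: (hX k) => hXk; definable HD.
  move=> c d cd; apply: NNPP => h.
  have {}h t : c < t < d -> X k t /\ a < t < b.
    by move=> ht; apply: NNPP => h'; apply: h; exists t.
  apply: hn; exists k, c, d; split=> //.
  (* If [c < a], this midpoint lies in the interval from [c] to [d] but to the left of [a];
     symmetrically for the right end. *)
  - apply: Rnot_lt_le => hac; have := h ((c + Rmin a d) / 2).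
    by move: (Rmin_l a d) (Rmin_r a d) (Rmin_glb_lt a d c hac cd); lra.
  - apply: Rnot_lt_le => hdb; have := h ((d + Rmax b c) / 2).
    by move: (Rmax_l b c) (Rmax_r b c) (Rmax_lub_lt b c d hdb cd); lra.
  - by move=> t ht; case: (h t ht).
pose l k := proj1_sig (constructive_indefinite_description _ (H k)).
have hl k t : X k t /\ a < t < b -> In t (l k).
  exact: (proj2_sig (constructive_indefinite_description _ (H k))).
pose u n : R := if @unpickle (nat * nat)%type n is Some (k, j) then List.nth j (l k) 0 else 0.
have [t [tab hu]] := interval_uncountable u ab.
have [k hk] := hc t tab.
have [j [hj e]] := In_nth _ _ 0 (hl k t (conj hk tab)).
by apply: (hu (pickle (k, j))); rewrite /u pickleK.
Qed.

End Line.

(** * Sample points *)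

(** Real m-space as iterated pairs, so that an induction on the dimension can split off the first
    coordinate. *)
Fixpoint Rn (m : nat) : rspace :=
  match m with 0%N => unit_sp | k.+1 => prod_sp R_sp (Rn k) end.

(** Sup-norm proximity. The radius is a coordinate like the others, so that quantifying over radii
    stays definable. *)
Fixpoint near (m : nat) : prod_sp R_sp (prod_sp (Rn m) (Rn m)) -> Prop :=
  match m with
  | 0%N => fun _ => True
  | k.+1 => fun z => Rabs (z.2.1.1 - z.2.2.1) < z.1 /\ @near k (z.1, (z.2.1.2, z.2.2.2))
  end.

Lemma near_sym m e (x y : Rn m) : near (e, (x, y)) -> near (e, (y, x)).
Proof.
elim: m x y => //= m IH [t x] [s y] /= [h1 h2]; split; last exact: IH.
by rewrite Rabs_minus_sym.
Qed.

Lemma near_trans m e e' (x y z : Rn m) :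
  near (e, (x, y)) -> near (e', (y, z)) -> near (e + e', (x, z)).
Proof.
elim: m x y z => //= m IH [t x] [s y] [r z] /= [h1 h2] [h3 h4]; split; last exact: IH h2 h4.
apply: Rle_lt_trans (Rplus_lt_compat _ _ _ _ h1 h3).
by apply: Rle_trans (Rabs_triang _ _); right; congr Rabs; lra.
Qed.

Lemma near_le m e e' (x y : Rn m) : e <= e' -> near (e, (x, y)) -> near (e', (x, y)).
Proof.
by move=> he; elim: m x y => //= m IH [t x] [s y] /= [h1 h2]; split; [lra | apply: IH].
Qed.

Lemma near_open m e (x y : Rn m) : near (e, (x, y)) ->
  exists2 d, 0 < d & forall z, near (d, (z, x)) -> near (e, (z, y)).
Proof.
elim: m x y => [|m IH] /= x y; first by exists 1; [lra|].
case: x y => [t x] [s y] /= [h1 /IH [d hd h2]].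
exists (Rmin d (e - Rabs (t - s))); first by apply: Rmin_glb_lt => //; lra.
move=> [r z] /= [h3 h4]; split.
  have := Rmin_r d (e - Rabs (t - s)); have := Rabs_triang (r - t) (t - s).
  have -> : r - t + (t - s) = r - s by lra.
  lra.
by apply: h2; apply: near_le h4; apply: Rmin_l.
Qed.

Lemma near_separated m (x y : Rn m) : x <> y -> exists2 d, 0 < d & ~ near (d, (x, y)).
Proof.
elim: m x y => [|m IH] /=; first by move=> [] [].
move=> [t x] [s y] hn; case: (Req_dec t s) => [e|ts].
  have [|d hd h] := IH x y; first by move=> exy; apply: hn; rewrite e exy.
  by exists d => // -[_ /=].
exists (Rabs (t - s)); first by apply: Rabs_pos_lt; lra.
by move=> [/=]; lra.
Qed.

Lemma list_min_pos (T : Type) (P : T -> R -> Prop) (l : list T) :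
  (forall x d d', 0 < d' <= d -> P x d -> P x d') ->
  (forall x, In x l -> exists2 d, 0 < d & P x d) ->
  exists2 d, 0 < d & forall x, In x l -> P x d.
Proof.
move=> mono; elim: l => [|a l IH] h; first by exists 1; [lra|].
have [d1 hd1 h1] := h a (or_introl erefl).
have [|d2 hd2 h2] := IH; first by move=> x hx; apply: h; right.
exists (Rmin d1 d2); first exact: Rmin_glb_lt.
move=> x /= [<-|hx].
  by apply: mono h1; split; [apply: Rmin_glb_lt | apply: Rmin_l].
by apply: mono (h2 _ hx); split; [apply: Rmin_glb_lt | apply: Rmin_r].
Qed.

Lemma list_separated m (l : list (Rn m)) :
  exists2 d, 0 < d & forall x y, In x l -> In y l -> near (d, (x, y)) -> x = y.
Proof.
have [||d hd h] := @list_min_pos (Rn m * Rn m)%type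
  (fun p d => near (d, p) -> p.1 = p.2) (list_prod l l).
- by move=> [x y] d d' [_ le] h /(near_le le).
- move=> [x y] _; case: (classic (x = y)) => [->|/near_separated [d hd h]]; first by exists 1; [lra|].
  by exists d.
by exists d => // x y hx hy; apply: (h (x, y)); apply/in_prod_iff.
Qed.

(** The lattice of mesh [r]. Integers are written as differences of naturals, which makes the
    indices a countable type that [pickle] can enumerate. *)
Fixpoint grid (m : nat) (r : R) (c : seq (nat * nat)) : Rn m :=
  match m with
  | 0%N => tt
  | k.+1 => (r * (INR (head (0%N, 0%N) c).1 - INR (head (0%N, 0%N) c).2),
             grid k r (behead c))
  end.

Lemma real_nat_diff (x : R) : exists a b : nat, Rabs (x - (INR a - INR b)) < 1.
Proof.
have H y : 0 <= y -> exists a : nat, Rabs (y - INR a) < 1.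
  move=> hy; have [h1 h2] := archimed y.
  have hz : (0 <= up y - 1)%Z by have : (0 < up y)%Z; [apply: lt_IZR; lra | lia].
  exists (Z.to_nat (up y - 1)); rewrite INR_IZR_INZ Z2Nat.id // minus_IZR.
  case: (Req_dec (IZR (up y) - y) 1) => e.
    by have -> : y - (IZR (up y) - 1) = 0 by [lra]; rewrite Rabs_R0; lra.
  by apply: Rabs_def1; lra.
case: (Rle_lt_dec 0 x) => hx.
  by have [a h] := H x hx; exists a, 0%N; rewrite /= Rminus_0_r.
have [|a h] := H (- x); first lra.
exists 0%N, a; rewrite -Rabs_Ropp /=.
by have -> : - (x - (0 - INR a)) = - x - INR a by lra.
Qed.

Lemma grid_dense m r (x : Rn m) : 0 < r -> exists c, near (r, (x, grid m r c)).
Proof.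
move=> hr; elim: m x => [|m IH] /=; first by exists [::].
move=> [t x]; have [c hc] := IH x; have [a [b hab]] := real_nat_diff (t / r).
exists ((a, b) :: c) => /=; split=> //.
have -> : t - r * (INR a - INR b) = r * (t / r - (INR a - INR b)) by field; lra.
by rewrite Rabs_mult (Rabs_right r); [nra|lra].
Qed.

Lemma inv_INR_lt e : 0 < e -> exists n : nat, 0 < / INR n.+1 < e.
Proof.
move=> he; have [n hn] := INR_unbounded (/ e); exists n.
have h1 : / e < INR n.+1 by rewrite S_INR; lra.
have h0 : 0 < / e by exact: Rinv_0_lt_compat.
split; first by apply: Rinv_0_lt_compat; lra.
by rewrite -[X in _ < X]Rinv_inv; apply: Rinv_lt_contravar => //; nra.
Qed.

(** * Variation of a finite fibre with the first coordinate *)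

Definition finite_pred (T : Type) (X : T -> Prop) := exists l : list T, forall x, X x -> In x l.

(** Required for every [eps], this is continuity at [e] of the fibre of [Y] for the Hausdorff
    distance; it also forbids a fibre to become empty or to cease to be so. *)
Definition hausdorff_near m (Y : prod_sp R_sp (Rn m) -> Prop) (e eps : R) : Prop :=
  exists d, 0 < d /\ forall t, Rabs (t - e) < d ->
    (forall y, Y (e, y) -> exists z, Y (t, z) /\ near (eps, (z, y))) /\
    (forall z, Y (t, z) -> exists y, Y (e, y) /\ near (eps, (z, y))).

Definition sign_stable m (Y C : prod_sp R_sp (Rn m) -> Prop) (e : R) : Prop :=
  exists d, 0 < d /\ forall t, Rabs (t - e) < d ->
    forall y z, Y (e, y) -> Y (t, z) -> near (d, (z, y)) -> (C (t, z) <-> C (e, y)).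

Definition stable_at m (Y C : prod_sp R_sp (Rn m) -> Prop) (e : R) : Prop :=
  (forall eps, 0 < eps -> hausdorff_near Y e eps) /\ sign_stable Y C e.

Section Sampling.

Variable D : om_structure.
Hypothesis HD : is_ominimal_expansion D.

Lemma Def_near m : Def D (@near m).
Proof.
elim: m => [|m IH]; first exact: (Def_const HD).
rewrite /=; definable HD.
Qed.

Lemma Def_forall_In (G : rspace) (I : Type) (X : I -> G -> Prop) (l : list I) :
  (forall i, Def D (X i)) -> Def D (fun x => forall i, In i l -> X i x).
Proof.
move=> hX; elim: l => [|a l IH]; first by apply: (Def_ext HD (Def_const HD G True)).
apply: (Def_ext HD (Def_and HD (hX a) IH)) => x; split.
  by move=> [h1 h2] i /= [<-|]; [|apply: h2].
by move=> h; split=> [|i hi]; apply: h; [left|right].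
Qed.

Lemma Def_exists_In (G : rspace) (I : Type) (X : I -> G -> Prop) (l : list I) :
  (forall i, Def D (X i)) -> Def D (fun x => exists i, In i l /\ X i x).
Proof.
move=> hX; apply: (Def_ext HD (Def_not HD (@Def_forall_In G I (fun i x => ~ X i x) l _))).
  by move=> i; apply: (Def_not HD).
move=> x; split.
  move=> h; apply: NNPP => h'; apply: h => i hi hXi; apply: h'; by exists i.
by move=> [i [hi hXi]] h; apply: (h i hi).
Qed.

(** A fibre is described up to [eps] by a mesh, the list of grid cells it occupies, and the side of
    [C] taken in each cell. There are countably many such descriptions, so [countable_cover] yields
    a subinterval on which one of them is constant. *)
Lemma stable_on_subinterval m (Y C : prod_sp R_sp (Rn m) -> Prop) a b eps :
  Def D Y -> Def D C ->
  (forall t, finite_pred (fun y => Y (t, y))) -> a < b -> 0 < eps ->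
  exists c d, [/\ a <= c, c < d, d <= b &
    forall e, c < e < d -> hausdorff_near Y e eps /\ sign_stable Y C e].
Proof.
move=> hY hC Yfin ab heps.
have hN := Def_near m.
pose cells (n : nat) (L : seq (seq (nat * nat) * bool)) t :=
  2 * / INR n.+1 <= eps /\
  (forall y, Y (t, y) -> exists i, In i L /\ near (/ INR n.+1, (y, grid m (/ INR n.+1) i.1))) /\
  (forall i, In i L ->
    (exists y, Y (t, y) /\ near (/ INR n.+1, (y, grid m (/ INR n.+1) i.1))) /\
    (forall y, Y (t, y) -> near (/ INR n.+1, (y, grid m (/ INR n.+1) i.1)) -> (C (t, y) <-> i.2))).
pose X k t := if @unpickle (nat * seq (seq (nat * nat) * bool))%type k is Some (n, L)
  then cells n L t else False.
case: (@countable_cover D HD X a b ab).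
- move=> k; rewrite /X; case: unpickle => [[n L]|]; last exact: (Def_const HD).
  rewrite /cells; apply: (Def_and HD); first exact: (Def_const HD).
  apply: (Def_and HD).
    refine (Def_all HD (T := Rn m) _); apply: (Def_imp HD); first by definable HD.
    by apply: Def_exists_In => i; definable HD.
  apply: Def_forall_In => i; apply: (Def_and HD).
    refine (Def_ex HD (T := Rn m) _); apply: (Def_and HD); first by definable HD.
    by definable HD.
  refine (Def_all HD (T := Rn m) _); apply: (Def_imp HD); first by definable HD.
  apply: (Def_imp HD); first by definable HD.
  by definable HD.
(* Every [t] has a description: once [2 * r] is at most the separation of the finite fibre, a cell
   holds at most one of its points, hence has one well-defined side of [C]. *)
- move=> t tab; have [l hl] := Yfin t.
  have [d hd hsep] := list_separated l.
  have [|n [hn0 hn]] := @inv_INR_lt (Rmin eps d / 2).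
    by have := Rmin_glb_lt _ _ _ heps hd; lra.
  set r := / INR n.+1 in hn0 hn.
  have [he hrd] : 2 * r <= eps /\ 2 * r <= d.
    by move: (Rmin_l eps d) (Rmin_r eps d); lra.
  have [L [hL1 hL2]] : exists L : seq (seq (nat * nat) * bool),
     (forall y, In y l -> Y (t, y) -> exists i, In i L /\ near (r, (y, grid m r i.1))) /\
     (forall i, In i L -> exists y, [/\ Y (t, y), near (r, (y, grid m r i.1)) & (C (t, y) <-> i.2)]).
    elim: l {hl hsep} => [|y l [L [h1 h2]]]; first by exists [::].
    case: (classic (Y (t, y))) => hy; last first.
      by exists L; split=> // z /= [<- //|hz]; apply: h1.
    have [c hc] := grid_dense y hn0.
    have [s hs] : exists s : bool, C (t, y) <-> s.
      by case: (classic (C (t, y))) => h; [exists true | exists false].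
    exists ((c, s) :: L); split.
      move=> z /= [<- _|hz /(h1 _ hz) [i [hi hi']]]; first by exists (c, s); split=> //; left.
      by exists i; split=> //; right.
    by move=> i /= [<-|/h2 //]; exists y.
  exists (pickle (n, L)); rewrite /X pickleK; split=> //; split.
    by move=> y hy; apply: hL1 => //; apply: hl.
  move=> i /hL2 [y [hy hyi hs]]; split; first by exists y.
  move=> z hz hzi; suff -> : z = y by [].
  apply: hsep; [exact: hl|exact: hl|].
  apply: (near_le hrd); have -> : 2 * r = r + r by lra.
  by apply: near_trans hzi (near_sym hyi).
move=> k [c [d [ac cd db hk]]]; exists c, d; split=> // e hce.
move: hk; rewrite /X; case: unpickle => [[n L]|] hk; last by case: (hk e hce).
set r := / INR n.+1 in hk.
have [he [hcov hL]] := hk e hce.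
have hde : 0 < Rmin (e - c) (d - e) by apply: Rmin_glb_lt; lra.
have htk t : Rabs (t - e) < Rmin (e - c) (d - e) -> c < t < d.
  by move=> /Rabs_def2; move: (Rmin_l (e - c) (d - e)) (Rmin_r (e - c) (d - e)); lra.
split.
- exists (Rmin (e - c) (d - e)); split=> // t /htk ht.
  have [_ [tcov tL]] := hk t ht.
  split.
    move=> y /hcov [i [hi hyi]]; have [[z [hz hzi]] _] := tL i hi.
    exists z; split=> //; apply: (near_le he); have -> : 2 * r = r + r by lra.
    exact: near_trans hzi (near_sym hyi).
  move=> z /tcov [i [hi hyi]]; have [[y [hy hzi]] _] := hL i hi.
  exists y; split=> //; apply: (near_le he); have -> : 2 * r = r + r by lra.
  exact: near_trans hyi (near_sym hzi).
(* Cells are open, so a point [z] close to [y] lies in the cell of [y], and both take the side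
   recorded for that cell. Finiteness of the fibre over [e] makes the radius uniform in [y]. *)
- have [l hl] := Yfin e.
  have [||d0 hd0 h0] := @list_min_pos (Rn m) (fun y d0 => Y (e, y) ->
     forall t, c < t < d -> forall z, Y (t, z) -> near (d0, (z, y)) -> (C (t, z) <-> C (e, y))) l.
  + by move=> y d1 d2 [_ le] h hy t ht z hz hzy; apply: h => //; apply: near_le hzy.
  + move=> y _; case: (classic (Y (e, y))) => hy; last by exists 1; [lra|].
    have [i [hi hyi]] := hcov y hy; have [d0 hd0 h0] := near_open hyi.
    exists d0 => // _ t ht z hz hzy; have [_ [_ tL]] := hk t ht.
    have [_ h1] := tL i hi; have [_ h2] := hL i hi.
    by rewrite (h1 z hz (h0 _ hzy)) (h2 y hy hyi).
  exists (Rmin d0 (Rmin (e - c) (d - e))); split; first exact: Rmin_glb_lt.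
  move=> t ht y z hy hz hzy; apply: (h0 y (hl y hy)) => //.
    by apply: htk; apply: Rlt_le_trans ht (Rmin_r _ _).
  by apply: near_le hzy; apply: Rmin_l.
Qed.

End Sampling.

(** Connectedness of a segment: if the supremum [b] of the points up to which [T] keeps its value at
    [x] were less than [y], local constancy at [b] would push it further. *)
Lemma locally_constant_interval (T : R -> Prop) x y : x <= y ->
  (forall e, x <= e <= y -> exists d, 0 < d /\ forall t, Rabs (t - e) < d -> (T t <-> T e)) ->
  (T x <-> T y).
Proof.
move=> xy hloc.
pose E t := x <= t <= y /\ forall s, x <= s <= t -> (T s <-> T x).
have Ex : E x by split; [lra | move=> s hs; have -> : s = x by lra].
case: (completeness E); [by exists y => t [[]] | by exists x|].
move=> b [hub hlub].
have xb : x <= b by apply: hub.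
have bly : b <= y by apply: hlub => t [[]].
have [d [hd hbd]] := hloc b (conj xb bly).
have [t0 [Et0 ht0]] : exists t, E t /\ b - d < t.
  apply: NNPP => h; suff : b <= b - d by lra.
  by apply: hlub => t Et; apply: Rnot_lt_le => h'; apply: h; exists t.
have t0b : t0 <= b by apply: hub.
have hTb : T b <-> T x.
  have [_ h] := Et0; rewrite -(h t0); last by case: Et0; lra.
  by apply: iff_sym; apply: hbd; apply: Rabs_def1; lra.
have hE s : x <= s <= y -> s < b + d -> (T s <-> T x).
  move=> hs hsd; case: (Rle_lt_dec s t0) => hst.
    by have [_ h] := Et0; apply: h; lra.
  by rewrite -hTb; apply: hbd; apply: Rabs_def1; lra.
have [//|hby] := Req_dec b y; first by move=> <-; apply: iff_sym.
suff : Rmin y (b + d / 2) <= b.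
  by move: (Rmin_glb_lt y (b + d / 2) b); lra.
move: (Rmin_l y (b + d / 2)) (Rmin_r y (b + d / 2)) (Rmin_glb_lt y (b + d / 2) b) => m1 m2 m3.
apply: hub; split; first lra.
by move=> s hs; apply: hE; lra.
Qed.

Lemma list_max_sat (p : R -> Prop) (l : list R) : (exists z, In z l /\ p z) ->
  exists z, p z /\ forall z', In z' l -> p z' -> z' <= z.
Proof.
elim: l => [|a l IH]; first by case=> z [[]].
case: (classic (exists z, In z l /\ p z)) => [/IH [z [hz hm]] _|hn].
  case: (classic (p a /\ z < a)) => [[pa za]|h].
    by exists a; split=> // z' /= [<-|hz' pz']; [lra|have := hm z' hz' pz'; lra].
  by exists z; split=> // z' /= [<- pa|]; [apply: Rnot_lt_le => h'; apply: h|apply: hm].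
move=> [z [/= [<-|hz] pz]]; last by case: hn; exists z.
by exists a; split=> // z' /= [<-|hz' pz']; [lra|case: hn; exists z'].
Qed.

Lemma list_min_sat (p : R -> Prop) (l : list R) : (exists z, In z l /\ p z) ->
  exists z, p z /\ forall z', In z' l -> p z' -> z <= z'.
Proof.
move=> [z [hz pz]].
have [|y [py hy]] := @list_max_sat (fun t => p (- t)) (List.map Ropp l).
  by exists (- z); rewrite Ropp_involutive; split=> //; apply: in_map.
exists (- y); split=> // z' hz' pz'.
by have := hy (- z') (in_map _ _ _ hz'); rewrite Ropp_involutive => /(_ pz'); lra.
Qed.

(** [T] is constant on each component of the complement of [Z]. The component of [e0] contains 0 if
    it is the whole line, [z - 1] or [z + 1] if it is a half-line ending at [z], and the midpoint of
    its ends otherwise. *)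
Lemma sample_line (T Z : R -> Prop) (e0 : R) : finite_pred Z ->
  (forall e, ~ Z e -> exists d, 0 < d /\ forall t, Rabs (t - e) < d -> (T t <-> T e)) ->
  T e0 ->
  exists s, T s /\ (s = 0 \/ Z s \/ (exists z, Z z /\ (s = z + 1 \/ s = z - 1)) \/
    (exists z1 z2, Z z1 /\ Z z2 /\ s = (z1 + z2) * (1/2))).
Proof.
move=> [l hl] hloc Te0.
case: (classic (Z e0)) => hZ0; first by exists e0; split=> //; right; left.
have conn s : (forall z, Z z -> Rmin s e0 <= z <= Rmax s e0 -> False) -> T s.
  move=> h; case: (Rle_lt_dec s e0) => hs.
    apply/(@locally_constant_interval T s e0 hs) => // e he; apply: hloc => hZ.
    by apply: (h e hZ); rewrite Rmin_left // Rmax_right.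
  apply/(@locally_constant_interval T e0 s (Rlt_le _ _ hs)) => // e he; apply: hloc => hZ.
  by apply: (h e hZ); rewrite Rmin_right ?Rmax_left //; lra.
have bnd s e : Rmin s e0 <= e <= Rmax s e0 -> (s <= e <= e0 \/ e0 <= e <= s).
  by rewrite /Rmin /Rmax; case: Rle_dec => h; [left | right]; lra.
case: (classic (exists z, In z l /\ (Z z /\ z < e0))) => hL; last first.
  case: (classic (exists z, In z l /\ (Z z /\ e0 < z))) => hR; last first.
    exists 0; split; last by left.
    apply: conn => z hz _; case: (Rtotal_order z e0) => [h|[h|h]].
    - by apply: hL; exists z; split=> //; apply: hl.
    - by apply: hZ0; rewrite -h.
    - by apply: hR; exists z; split=> //; apply: hl.
  have [z1 [[hz1 h1] hm]] := list_min_sat hR.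
  exists (z1 - 1); split; last by right; right; left; exists z1; split=> //; right.
  apply: conn => z hz /bnd hb; case: (Rtotal_order z e0) => [h|[h|h]].
  - by apply: hL; exists z; split=> //; apply: hl.
  - by apply: hZ0; rewrite -h.
  - by have := hm z (hl z hz) (conj hz h); lra.
have [z1 [[hz1 h1] hm1]] := list_max_sat hL.
case: (classic (exists z, In z l /\ (Z z /\ e0 < z))) => hR; last first.
  exists (z1 + 1); split; last by right; right; left; exists z1; split=> //; left.
  apply: conn => z hz /bnd hb; case: (Rtotal_order z e0) => [h|[h|h]].
  - by have := hm1 z (hl z hz) (conj hz h); lra.
  - by apply: hZ0; rewrite -h.
  - by apply: hR; exists z; split=> //; apply: hl.
have [z2 [[hz2 h2] hm2]] := list_min_sat hR.
exists ((z1 + z2) * (1/2)); split; last by right; right; right; exists z1, z2.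
apply: conn => z hz /bnd hb; case: (Rtotal_order z e0) => [h|[h|h]].
- by have := hm1 z (hl z hz) (conj hz h); lra.
- by apply: hZ0; rewrite -h.
- by have := hm2 z (hl z hz) (conj hz h); lra.
Qed.

Lemma hausdorff_near_le m (Y : prod_sp R_sp (Rn m) -> Prop) e eps eps' :
  eps <= eps' -> hausdorff_near Y e eps -> hausdorff_near Y e eps'.
Proof.
move=> le [d [hd h]]; exists d; split=> // t /h [h1 h2]; split.
  by move=> y /h1 [z [hz hzy]]; exists z; split=> //; apply: near_le hzy.
by move=> z /h2 [y [hz hzy]]; exists y; split=> //; apply: near_le hzy.
Qed.

(** [X] is a union of atoms of the Boolean algebra generated by the sets [C a]. Unlike an inductive
    description of Boolean combinations, this condition passes to fibres at once. *)
Definition saturated (P T : Type) (C : P -> T -> Prop) (A : list P) (X : T -> Prop) : Prop :=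
  forall x y, (forall a, In a A -> (C a x <-> C a y)) -> X x -> X y.

(** * Projections of Boolean combinations to the first coordinate *)

Section Projection.

Variable D : om_structure.
Hypothesis HD : is_ominimal_expansion D.

(** On an interval of unstable points, each point fails for some precision [/ INR k.+1]; by
    [countable_cover] one [k] fails on a whole subinterval, against [stable_on_subinterval]. *)
Lemma unstable_finite m (Y C : prod_sp R_sp (Rn m) -> Prop) : Def D Y -> Def D C ->
  (forall t, finite_pred (fun y => Y (t, y))) ->
  finite_pred (fun e => ~ stable_at Y C e).
Proof.
move=> hY hC Yfin; have hN := Def_near HD m.
apply: (Def_line_finite HD).
  by rewrite /stable_at /hausdorff_near /sign_stable; definable HD.
move=> a b ab; apply: NNPP => hn.
have hbad t : a < t < b -> ~ stable_at Y C t.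
  by move=> ht hs; apply: hn; exists t; split=> // h; apply: h.
pose X (k : nat) (t : R) := ~ (hausdorff_near Y t (/ INR k.+1) /\ sign_stable Y C t).
have [||k [c [d [ac cd db hk]]]] := @countable_cover D HD X a b ab.
- by move=> k; rewrite /X /hausdorff_near /sign_stable; definable HD.
- move=> t /hbad hb; apply: NNPP => hk; apply: hb; split.
    move=> eps /inv_INR_lt [k [_ hke]]; apply: (@hausdorff_near_le _ _ _ (/ INR k.+1)); first lra.
    by apply: NNPP => h; apply: hk; exists k => -[].
  by apply: NNPP => h; apply: hk; exists 0%N => -[].
have hk0 : 0 < / INR k.+1 by apply: Rinv_0_lt_compat; apply: lt_0_INR; lia.
have [c' [d' [h1 h2 h3 h4]]] := stable_on_subinterval HD hY hC Yfin cd hk0.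
have he : c' < (c' + d') / 2 < d' by lra.
by apply: (hk ((c' + d') / 2)); [lra | apply: h4].
Qed.

(** [Q] and [Y] are chosen before [A]: a longer list [A] only gives more parameters [q], never a
    more complicated family. The parameter [u] is common to all members, and receives the
    coordinates split off by induction. *)
Definition sampling (P U : rspace) (m : nat) (C : prod_sp (prod_sp P U) (Rn m) -> Prop) : Prop :=
  exists (Q : rspace) (sel : list P -> list Q) (Y : prod_sp (prod_sp Q U) (Rn m) -> Prop),
  [/\ Def D Y,
      forall q u, finite_pred (fun y => Y ((q, u), y)) &
      forall A u X, A <> nil -> saturated (fun a y => C ((a, u), y)) A X -> (exists y, X y) ->
        exists q y, [/\ In q (sel A), Y ((q, u), y) & X y]].

(** The fibre of [X] over [t] is nonempty when it contains a point of some sampling set. If each of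
    these sets is stable at [e] with respect to each member, its points over [t] and over [e] match
    up on the same sides of all members, hence agree on [X]. So [Z] collects the unstable points for
    one pair of a sample parameter and a member. *)
Lemma projection_locally_constant (P U : rspace) m
  (C : prod_sp (prod_sp P U) (Rn m.+1) -> Prop) :
  Def D C ->
  sampling (fun z : prod_sp (prod_sp P (prod_sp U R_sp)) (Rn m) =>
              C ((z.1.1, z.1.2.1), (z.1.2.2, z.2))) ->
  exists (Q : rspace) (sel : list P -> list Q) (Z : prod_sp (prod_sp Q U) R_sp -> Prop),
  [/\ Def D Z,
      forall q u, finite_pred (fun e => Z ((q, u), e)),
      forall A, A <> nil -> sel A <> nil &
      forall A u X, A <> nil -> saturated (fun a y => C ((a, u), y)) A X ->
        forall e, (forall q, In q (sel A) -> ~ Z ((q, u), e)) ->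
        exists d, 0 < d /\ forall t, Rabs (t - e) < d ->
          ((exists y, X (t, y)) <-> (exists y, X (e, y)))].
Proof.
move=> hC [Q [sel [Y [hY Yfin hsamp]]]]; have hN := Def_near HD m.
pose Yf q u := fun p : prod_sp R_sp (Rn m) => Y ((q, (u, p.1)), p.2).
pose Cf b u := fun p : prod_sp R_sp (Rn m) => C ((b, u), (p.1, p.2)).
exists (prod_sp Q P), (fun A => list_prod (sel A) A),
  (fun z => ~ stable_at (Yf z.1.1.1 z.1.2) (Cf z.1.1.2 z.1.2) z.2).
split.
- rewrite /stable_at /hausdorff_near /sign_stable /Yf /Cf; definable HD.
- move=> [q b] u; apply: (@unstable_finite m (Yf q u) (Cf b u)); rewrite /Yf /Cf.
  + by definable HD.
  + by definable HD.
  + by move=> t; exact: (Yfin q (u, t)).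
- move=> A hA hnil.
  (* Sampling the full set at an arbitrary point produces an element of [sel A]. *)
  have [|q [y' [hq _ _]]] := hsamp A (rdec (fun _ => 0)) (fun _ => True) hA (fun _ _ _ h => h).
    by exists (rdec (fun _ => 0)).
  case: A hA hnil hq => // a A _ hnil hq.
  have : In (q, a) (list_prod (sel (a :: A)) (a :: A)) by apply/in_prod_iff; split=> //; left.
  by rewrite hnil.
move=> A u X hA hX e hgood.
have hst q b : In q (sel A) -> In b A -> stable_at (Yf q u) (Cf b u) e.
  by move=> hq hb; apply: NNPP => h; apply: (hgood (q, b)) => //; apply/in_prod_iff.
pose X1 q t := exists y, Y ((q, (u, t)), y) /\ X (t, y).
have hX1 t : (exists y, X (t, y)) <-> exists q, In q (sel A) /\ X1 q t.
  split; last by move=> [q [_ [y [_ h]]]]; exists y.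
  move=> [y0 hy0]; have [||q [y [hq hy hXy]]] := hsamp A (u, t) (fun y => X (t, y)) hA.
  - by move=> x y h; apply: hX.
  - by exists y0.
  by exists q; split=> //; exists y.
have [||d hd hq] := @list_min_pos Q (fun q d => forall t, Rabs (t - e) < d -> (X1 q t <-> X1 q e)) (sel A).
- by move=> q d d' [_ le] h t ht; apply: h; lra.
- move=> q hq.
  (* One radius [d0] that preserves sides for every member [b]; Hausdorff continuity is then invoked
     with precision [d0], so that matched points are close enough. *)
  have [||d0 hd0 h0] := @list_min_pos P (fun b d => forall t, Rabs (t - e) < d ->
     forall y z, Yf q u (e, y) -> Yf q u (t, z) -> near (d, (z, y)) ->
     (Cf b u (t, z) <-> Cf b u (e, y))) A.
  + move=> b d d' [_ le] h t ht y z hy hz hzy; apply: h => //; first lra.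
    exact: near_le hzy.
  + by move=> b hb; have [_ [d [hd h]]] := hst q b hq hb; exists d.
  have [d1 [hd1 h1]] : hausdorff_near (Yf q u) e d0.
    case: A hA hq hst {hX hgood hX1 h0} => // b A _ hq hst.
    by have [h _] := hst q b hq (or_introl erefl); apply: h.
  exists (Rmin d0 d1); first exact: Rmin_glb_lt.
  move=> t ht.
  have t0 : Rabs (t - e) < d0 by apply: Rlt_le_trans ht (Rmin_l _ _).
  have t1 : Rabs (t - e) < d1 by apply: Rlt_le_trans ht (Rmin_r _ _).
  have [h2 h3] := h1 t t1; split.
  + move=> [z [hz hXz]]; have [y [hy hzy]] := h3 z hz; exists y; split=> //.
    by apply: (hX _ _ _ hXz) => b hb; exact: (h0 b hb t t0 y z).
  + move=> [y [hy hXy]]; have [z [hz hzy]] := h2 y hy; exists z; split=> //.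
    by apply: (hX _ _ _ hXy) => b hb; apply: iff_sym; exact: (h0 b hb t t0 y z).
exists d; split=> // t ht; rewrite !hX1.
by split=> -[q [hin h]]; exists q; split=> //; apply/(hq q hin t ht).
Qed.

(** The projection to the first coordinate is sampled by [sample_line], and the fibre over the
    chosen value by the induction hypothesis with that value moved into the parameters. *)
Lemma sampling_all m (P U : rspace) (C : prod_sp (prod_sp P U) (Rn m) -> Prop) :
  Def D C -> sampling C.
Proof.
elim: m P U C => [|m IH] P U C hC.
  exists unit_sp, (fun _ => [:: tt]), (fun _ => True); split.
  - exact: (Def_const HD).
  - by move=> q u; exists [:: tt] => -[] _; left.
  - by move=> A u X _ _ [y hy]; exists tt, y; split=> //; left.
have hsamp : sampling (fun z : prod_sp (prod_sp P (prod_sp U R_sp)) (Rn m) =>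
              C ((z.1.1, z.1.2.1), (z.1.2.2, z.2))) by apply: IH; definable HD.
have [Q1 [sel1 [Z [hZ Zfin Znil hproj]]]] := projection_locally_constant hC hsamp.
have [Q [sel [Y [hY Yfin hY']]]] := hsamp.
(* Two parameters in [Q1], because the ends of a bounded component may come from different members
   of the family [Z]. *)
exists (prod_sp Q (prod_sp Q1 Q1)),
  (fun A => list_prod (sel A) (list_prod (sel1 A) (sel1 A))),
  (fun z => Y ((z.1.1.1, (z.1.2, z.2.1)), z.2.2) /\
    (z.2.1 = 0 \/ Z ((z.1.1.2.1, z.1.2), z.2.1) \/
     (exists w, Z ((z.1.1.2.1, z.1.2), w) /\ (z.2.1 = w + 1 \/ z.2.1 = w - 1)) \/
     (exists w1 w2, Z ((z.1.1.2.1, z.1.2), w1) /\ Z ((z.1.1.2.2, z.1.2), w2) /\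
        z.2.1 = (w1 + w2) * (1/2)))).
split.
- by rewrite /=; definable HD.
- move=> [q [q1 q2]] u /=.
  have [l1 h1] := Zfin q1 u; have [l2 h2] := Zfin q2 u.
  (* All possible first coordinates of the sample points. *)
  pose ls := 0 :: l1 ++ List.map (fun w => w + 1) l1 ++ List.map (fun w => w - 1) l1 ++
     List.map (fun p => (p.1 + p.2) * (1/2)) (list_prod l1 l2).
  have H (l : list R) : exists L : list (R * Rn m), forall s y, In s l -> Y ((q, (u, s)), y) -> In (s, y) L.
    elim: l => [|s l [L hL]]; first by exists nil.
    have [l' hl'] := Yfin q (u, s).
    exists (List.map (fun y => (s, y)) l' ++ L) => s' y /= [<-|hs'] hy; apply/in_app_iff.
      by left; apply: in_map; apply: hl'.
    by right; apply: hL.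
  have [L hL] := H ls; exists L => -[s y] /= [hy hs]; apply: hL => //.
  case: hs => [->|[/h1 hs|[[w [/h1 hw hs]]|[w1 [w2 [/h1 hw1 [/h2 hw2 ->]]]]]]]; first by left.
  + by right; apply/in_app_iff; left.
  + right; apply/in_app_iff; right; apply/in_app_iff; case: hs => ->.
      by left; apply: (in_map (fun w => w + 1)).
    by right; apply/in_app_iff; left; apply: (in_map (fun w => w - 1)).
  + right; do 3 (apply/in_app_iff; right).
    by apply: (in_map (fun p => (p.1 + p.2) * (1/2)) _ (w1, w2)); apply/in_prod_iff.
move=> A u X hA hX [[e0 y0] hy0].
have [|||s [[y1 hy1] hs]] := @sample_line (fun t => exists y, X (t, y))
  (fun e => exists q, In q (sel1 A) /\ Z ((q, u), e)) e0.
- elim: (sel1 A) => [|q l [L hL]]; first by exists nil => x [q [[]]].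
  have [L' hL'] := Zfin q u.
  exists (L' ++ L) => x [q' [/= [<-|hq'] hx]]; apply/in_app_iff; first by left; apply: hL'.
  by right; apply: hL; exists q'.
- move=> e he; apply: (hproj A u X) => // q hq hz; apply: he; by exists q.
- by exists y0.
have [||q [y [hq hy hXy]]] := hY' A (u, s) (fun y => X (s, y)) hA.
- by move=> x y h; apply: hX.
- by exists y1.
have [q0 hq0] : exists q0, In q0 (sel1 A).
  by case: (sel1 A) (Znil A hA) => // q0 l _; exists q0; left.
case: hs => [hs|[[q1 [hq1 hz]]|[[w [[q1 [hq1 hz]] hs]]|[w1 [w2 [[q1 [hq1 hz1]] [[q2 [hq2 hz2]] hs]]]]]]].
- exists (q, (q0, q0)), (s, y); split=> //; first by do 2 (apply/in_prod_iff; split=> //).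
  by split=> //=; left.
- exists (q, (q1, q0)), (s, y); split=> //; first by do 2 (apply/in_prod_iff; split=> //).
  by split=> //=; right; left.
- exists (q, (q1, q0)), (s, y); split=> //; first by do 2 (apply/in_prod_iff; split=> //).
  by split=> //=; right; right; left; exists w.
- exists (q, (q1, q2)), (s, y); split=> //; first by do 2 (apply/in_prod_iff; split=> //).
  by split=> //=; right; right; right; exists w1, w2.
Qed.

End Projection.

(** * Uniform growth bounds *)

Section Growth.

Variable D : om_structure.
Hypothesis HD : is_ominimal_expansion D.
Hypothesis Hpb : polynomially_bounded D.

Lemma DefM_poly_bound (f : R_sp -> R_sp) : DefM D f ->
  exists (N : nat) (c : R), forall x, c < x -> Rabs (f x) < x ^ N.
Proof.
move=> hf; apply: Hpb; apply: (D_ext HD hf) => x /=.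
have <- : @lshift 1 1 ord0 = ord0 by apply: val_inj.
by have <- : @rshift 1 1 ord0 = ord_max by apply: val_inj.
Qed.

Variables (Th : rspace) (h : prod_sp Th R_sp -> R_sp).
Hypothesis hdef : DefM D h.
Hypothesis hpos : forall th t, 0 < t -> 0 < h (th, t).
Hypothesis hmono : forall th s t, 0 < s <= t -> h (th, s) <= h (th, t).

(** For [h] equal to a power [t ^ a] and positive [x], the largest such [m] is [x ^ a]: at [x = 2]
    it measures the exponent of growth. *)
Definition ratio_ge th (x m : R) : Prop :=
  exists t0, forall t, t0 < t -> m * h (th, t) <= h (th, x * t).

Lemma ratio_iter th x m t0 : 1 <= x -> 0 <= m -> 0 <= t0 ->
  (forall t, t0 < t -> m * h (th, t) <= h (th, x * t)) ->
  forall j t, t0 < t -> m ^ j * h (th, t) <= h (th, x ^ j * t).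
Proof.
move=> hx hm ht0 H; elim=> [|j IH] t ht; first by rewrite /= !Rmult_1_l; lra.
have hj := pow_R1_Rle x j hx.
have -> : x ^ j.+1 * t = x * (x ^ j * t) by rewrite /=; ring.
have -> : m ^ j.+1 * h (th, t) = m * (m ^ j * h (th, t)) by rewrite /=; ring.
apply: Rle_trans (H _ _); last by nra.
by apply: Rmult_le_compat_l => //; apply: IH.
Qed.

Lemma ratio_ge_pow th x m j : 1 <= x -> 0 <= m -> ratio_ge th x m -> ratio_ge th (x ^ j) (m ^ j).
Proof.
move=> hx hm [t0 H]; exists (Rmax t0 0); apply: ratio_iter => //; first exact: Rmax_r.
by move=> t ht; apply: H; apply: Rle_lt_trans ht; apply: Rmax_l.
Qed.

Lemma ratio_ge_le th x x' m m' : 0 < x <= x' -> m' <= m -> ratio_ge th x m -> ratio_ge th x' m'.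
Proof.
move=> hx hm [t0 H]; exists (Rmax t0 0) => t ht.
have ht0 : t0 < t by apply: Rle_lt_trans ht; apply: Rmax_l.
have t0' : 0 < t by apply: Rle_lt_trans ht; apply: Rmax_r.
have := H t ht0; have := hpos th t0'.
have : h (th, x * t) <= h (th, x' * t) by apply: hmono; nra.
nra.
Qed.

Lemma INR_le_pow2 k : INR k <= 2 ^ k.
Proof.
elim: k => [|k IH]; first by rewrite /=; lra.
by rewrite S_INR /=; have := pow_R1_Rle 2 k; lra.
Qed.

(** Let [t ^ N] bound the function eventually. A ratio of at least [2 * s ^ N], iterated [k] times
    from a fixed [t], would give [2 ^ k * h (th, t) < t ^ N] for all [k]. *)
Lemma ratio_ge_bounded th s : 2 <= s -> exists M, forall m, ratio_ge th s m -> m <= M.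
Proof.
move=> hs.
have hd : DefM D ((fun t => h (th, t)) : R_sp -> R_sp) by definable HD.
have [N [c hN]] := DefM_poly_bound hd.
exists (s ^ N.+1) => m [t0 H]; apply: Rnot_lt_le => hm.
have hsN := pow_R1_Rle s N.
have hm2 : 2 * s ^ N <= m by move: hm => /=; nra.
pose t1 := Rmax t0 (Rmax c 0); pose t := t1 + 1.
have [h1 [h2 h3]] : t0 <= t1 /\ c <= t1 /\ 0 <= t1.
  by move: (Rmax_l t0 (Rmax c 0)) (Rmax_r t0 (Rmax c 0)) (Rmax_l c 0) (Rmax_r c 0); rewrite /t1; lra.
have hit := @ratio_iter th s m t1 _ _ h3 _ _ t.
have hk k : 2 ^ k * h (th, t) < t ^ N.
  have a1 : m ^ k * h (th, t) <= h (th, s ^ k * t).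
    by apply: hit; [lra|lra|move=> u hu; apply: H; lra|rewrite /t; lra].
  have hsk := pow_R1_Rle s k.
  have a2 : h (th, s ^ k * t) < (s ^ k * t) ^ N.
    apply: Rle_lt_trans (Rle_abs _) (hN _ _).
    by have : 0 < t by [rewrite /t; lra]; have : 1 <= s ^ k by [apply: hsk; lra]; rewrite /t; nra.
  have a3 : (2 * s ^ N) ^ k <= m ^ k by apply: pow_incr; split=> //; nra.
  have a4 : (s ^ k * t) ^ N = (s ^ N) ^ k * t ^ N.
    by rewrite Rpow_mult_distr -!pow_mult Nat.mul_comm.
  move: a3; rewrite Rpow_mult_distr => a3.
  have hp : 0 < (s ^ N) ^ k by apply: pow_lt; lra.
  have hht : 0 < h (th, t) by apply: hpos; rewrite /t; lra.
  apply: (Rmult_lt_reg_l ((s ^ N) ^ k)) => //; nra.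
have hht : 0 < h (th, t) by apply: hpos; rewrite /t; lra.
have [k hkk] := INR_unbounded (t ^ N / h (th, t)).
have := hk k; have := INR_le_pow2 k.
have : t ^ N / h (th, t) * h (th, t) = t ^ N by field; lra.
nra.
Qed.

(** By o-minimality the inequality with factor [2 ^ N.+1] eventually holds or eventually fails. It
    cannot hold, so doubling [t] eventually multiplies the function by less than [2 ^ N.+1]. *)
Lemma growth_of_ratio_bound th (N : nat) :
  (forall m, ratio_ge th 2 m -> m <= 2 ^ N) ->
  exists t0, forall t, t0 < t -> h (th, t) <= t ^ N.+2.
Proof.
move=> hV.
have hd : Def D ((fun t => 2 ^ N.+1 * h (th, t) <= h (th, 2 * t)) : R_sp -> Prop).
  by definable HD.
have [t0 [ht|ht]] := Def_line_eventually HD hd.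
  have : 2 ^ N.+1 <= 2 ^ N by apply: hV; exists t0.
  by have := pow_R1_Rle 2 N; rewrite /=; lra.
pose t1 := Rmax t0 0 + 1.
have h1 : t0 < t1 by have := Rmax_l t0 0; rewrite /t1; lra.
have h2 : 1 <= t1 by have := Rmax_r t0 0; rewrite /t1; lra.
pose K := h (th, 2 * t1).
have hK : 0 < K by apply: hpos; lra.
(* Induction on dyadic scales; up to [2 * t1] monotonicity gives the bound [K]. The factor [K] is
   later absorbed by one more power of [t]. *)
have claim k t : t1 <= t <= 2 ^ k * t1 -> h (th, t) <= K * t ^ N.+1.
  elim: k t => [|k IH] t htt.
    have ht1 : 1 <= t ^ N.+1 by apply: pow_R1_Rle; lra.
    have : h (th, t) <= K by apply: hmono; move: htt => /=; lra.
    nra.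
  case: (Rle_lt_dec t (2 * t1)) => h3.
    have ht1 : 1 <= t ^ N.+1 by apply: pow_R1_Rle; lra.
    have : h (th, t) <= K by apply: hmono; lra.
    nra.
  have h4 : h (th, t / 2) <= K * (t / 2) ^ N.+1 by apply: IH; move: htt => /=; lra.
  have h5 : ~ (2 ^ N.+1 * h (th, t / 2) <= h (th, 2 * (t / 2))) by apply: ht; lra.
  have e : 2 * (t / 2) = t by field.
  have h6 : h (th, t) <= 2 ^ N.+1 * h (th, t / 2) by rewrite e in h5; lra.
  have -> : t ^ N.+1 = 2 ^ N.+1 * (t / 2) ^ N.+1 by rewrite -Rpow_mult_distr e.
  have := pow_R1_Rle 2 N.+1.
  nra.
exists (Rmax t1 K) => t htt.
have h3 : t1 < t by apply: Rle_lt_trans htt; apply: Rmax_l.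
have h4 : K < t by apply: Rle_lt_trans htt; apply: Rmax_r.
have [k hk] := INR_unbounded t.
have h5 : h (th, t) <= K * t ^ N.+1.
  apply: (claim k); have := INR_le_pow2 k; nra.
have : 1 <= t ^ N.+1 by apply: pow_R1_Rle; lra.
by have -> : t ^ N.+2 = t * t ^ N.+1 by []; nra.
Qed.

(* If the ratios at 2 were unbounded over the family, then
   s |-> sup {m | h_th(s t) >= m h_th(t) eventually, whenever h_th(2 t) >= s h_th(t) eventually}
   would be definable and dominate s^(log2 s). *)
Lemma uniform_growth : exists N : nat, forall th, exists t0, forall t, t0 < t -> h (th, t) <= t ^ N.
Proof.
case: (classic (exists M, forall th m, ratio_ge th 2 m -> m <= M)) => [[M hM]|hunb].
  have [N hN] := INR_unbounded M.
  exists N.+2 => th; apply: growth_of_ratio_bound => m /hM.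
  by have := INR_le_pow2 N; lra.
have {}hunb M : exists th, ratio_ge th 2 M.
  apply: NNPP => hn; apply: hunb; exists M => th m hm; apply: Rnot_lt_le => lt.
  by apply: hn; exists th; apply: ratio_ge_le hm; lra.
pose S s m := forall th, ratio_ge th 2 s -> ratio_ge th s m.
(* Graph of the supremum of [S s], with value 0 below 2 to make the function total. *)
pose G s y := (s < 2 /\ y = 0) \/
  (2 <= s /\ (forall m, S s m -> m <= y) /\ (forall y', (forall m, S s m -> m <= y') -> y <= y')).
(* A ratio [s] at 2 iterates to a ratio [s ^ j] at [2 ^ j], hence at the larger argument [s]. *)
have S_pow s (j : nat) : 2 <= s -> 2 ^ j <= s -> S s (s ^ j).
  move=> hs hj th hth; apply: (@ratio_ge_le th (2 ^ j) s (s ^ j)); [|lra|].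
    by split=> //; apply: pow_lt; lra.
  by apply: ratio_ge_pow => //; lra.
have exG s : exists y, G s y.
  case: (Rlt_le_dec s 2) => hs; first by exists 0; left.
  case: (completeness (S s)).
  (* Unboundedness of the ratios at 2 is what makes [S s] bounded: a single [th] satisfying its
     premise suffices. *)
  - have [th hth] := hunb s; have [M hM] := ratio_ge_bounded th hs.
    by exists M => m hm; apply: hM; apply: hm.
  - by exists (s ^ 0); apply: S_pow => //=; lra.
  by move=> y [h1 h2]; exists y; right; split.
have uniqG s y y' : G s y -> G s y' -> y = y'.
  move=> [[h1 ->]|[h1 [h2 h3]]] [[h4 ->]|[h4 [h5 h6]]] //; try lra.
  by apply: Rle_antisym; [apply: h3 | apply: h6].
pose psi s := proj1_sig (constructive_indefinite_description _ (exG s)).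
have hpsi s : G s (psi s) by exact: (proj2_sig (constructive_indefinite_description _ (exG s))).
have dpsi : DefM D (psi : R_sp -> R_sp).
  have dG : Def D (fun z : prod_sp R_sp R_sp => G z.1 z.2).
    by rewrite /G /S /ratio_ge; definable HD.
  apply: (Def_ext HD dG) => z; split; first by apply: uniqG; apply: hpsi.
  by move=> <-; apply: hpsi.
have [N [c hc]] := DefM_poly_bound dpsi.
(* Large enough for [psi s < s ^ N] and, since [2 ^ N <= s], for [s ^ N <= psi s]. *)
pose s := Rmax c (Rmax 2 (2 ^ N)) + 1.
have [h1 [h2 h3]] : c < s /\ 2 <= s /\ 2 ^ N <= s.
  by move: (Rmax_l c (Rmax 2 (2 ^ N))) (Rmax_r c (Rmax 2 (2 ^ N))) (Rmax_l 2 (2 ^ N)) (Rmax_r 2 (2 ^ N)); rewrite /s; lra.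
have := hc s h1; have := Rle_abs (psi s).
case: (hpsi s) => [[]|[_ [hub _]]]; first lra.
by have := hub _ (S_pow s N h2 h3); lra.
Qed.

End Growth.

(** * Compactness *)

(** The indices satisfy [k <= s k] instead of increasing strictly; this is enough for limits and is
    preserved when extractions are composed. *)
Lemma bounded_subsequence (u : nat -> R) M : (forall k, Rabs (u k) <= M) ->
  exists (s : nat -> nat) l, (forall k, (k <= s k)%coq_nat) /\
    forall d, 0 < d -> exists K, forall k, (K <= k)%coq_nat -> Rabs (u (s k) - l) < d.
Proof.
move=> hM.
have [|l hl] := @Bolzano_Weierstrass u (fun c => - M <= c <= M) (compact_P3 _ _).
  by move=> k; have := hM k; rewrite /Rabs; case: Rcase_abs; lra.
have H k : exists j, (k <= j)%coq_nat /\ Rabs (u j - l) < / INR k.+1.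
  have hk : 0 < / INR k.+1 by apply: Rinv_0_lt_compat; apply: lt_0_INR; lia.
  have [|j [hj hd]] := hl (disc l (mkposreal _ hk)) k.
    by exists (mkposreal _ hk) => x.
  by exists j.
pose s k := proj1_sig (constructive_indefinite_description _ (H k)).
have hs k : (k <= s k)%coq_nat /\ Rabs (u (s k) - l) < / INR k.+1.
  exact: (proj2_sig (constructive_indefinite_description _ (H k))).
exists s, l; split=> [k|d hd]; first by case: (hs k).
have [K [_ hK]] := inv_INR_lt hd; exists K => k hk.
have [_ h] := hs k; apply: Rlt_trans h _; apply: Rle_lt_trans hK.
apply: Rinv_le_contravar; first by apply: lt_0_INR; lia.
by apply: le_INR; lia.
Qed.

Lemma bounded_subsequence_pt n (u : nat -> pt n) M : (forall k i, Rabs (u k i) <= M) ->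
  exists (s : nat -> nat) (x : pt n), (forall k, (k <= s k)%coq_nat) /\
    forall d, 0 < d -> exists K, forall k, (K <= k)%coq_nat -> om_near_pt x (u (s k)) d.
Proof.
elim: n u => [|n IH] u hM.
  by exists id, (fun _ => 0); split=> // d hd; exists 0%N => k _ [].
have [s1 [l [hs1 h1]]] := @bounded_subsequence (fun k => u k ord0) M (fun k => hM k ord0).
have [s2 [x [hs2 h2]]] := IH (fun k => om_tailc (u (s1 k))) (fun k i => hM _ _).
exists (fun k => s1 (s2 k)), (fun i => if unlift ord0 i is Some j then x j else l); split.
  by move=> k; have := hs1 (s2 k); have := hs2 k; lia.
move=> d hd; have [K1 hK1] := h1 d hd; have [K2 hK2] := h2 d hd.
exists (K1 + K2)%coq_nat => k hk i; case: (unliftP ord0 i) => [j|] ->.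
  by apply: (hK2 k _ j); lia.
by apply: hK1; have := hs2 k; lia.
Qed.

Lemma locally_bounded_compact n (S : set_ n) (phi : pt n -> R) :
  om_closed_set S -> om_bounded_set S ->
  (forall x, S x -> exists d c, 0 < d /\ forall y, S y -> om_near_pt x y d -> phi y <= c) ->
  exists c, forall y, S y -> phi y <= c.
Proof.
move=> hcl [M hM] hloc; apply: NNPP => hn.
have H (k : nat) : exists y, S y /\ INR k < phi y.
  apply: NNPP => h; apply: hn; exists (INR k) => y hy; apply: Rnot_lt_le => lt.
  by apply: h; exists y.
pose u k := proj1_sig (constructive_indefinite_description _ (H k)).
have hu k : S (u k) /\ INR k < phi (u k).
  exact: (proj2_sig (constructive_indefinite_description _ (H k))).
have [s [x [hs hx]]] := @bounded_subsequence_pt n u M (fun k => hM _ (proj1 (hu k))).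
have Sx : S x.
  apply: NNPP => /hcl [e [he hnear]]; have [K hK] := hx e he.
  by apply: (hnear _ (hK K (le_n K))); case: (hu (s K)).
have [d [c [hd hc]]] := hloc x Sx.
have [K hK] := hx d hd; have [k hk] := INR_unbounded c.
have := hc _ (proj1 (hu _)) (hK (K + k)%coq_nat _); have := proj2 (hu (s (K + k)%coq_nat)).
have : INR k <= INR (s (K + k)%coq_nat) by apply: le_INR; have := hs (K + k)%coq_nat; lia.
by move=> h1 h2 h3; have := h3 (Nat.le_add_r _ _); lra.
Qed.

(** Where [v <= Rabs (g x)] the function [f] does not vanish, so the quotient is locally bounded
    there. For [N] equal to 0 the conclusion is a positive lower bound for [|f|]. *)
Lemma power_bound_away n (S : set_ n) (f g : pt n -> R) (v : R) (N : nat) :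
  om_closed_set S -> om_bounded_set S ->
  om_continuous_on f S -> om_continuous_on g S ->
  (forall x, S x -> f x = 0 -> g x = 0) -> 0 < v ->
  exists c, forall x, S x -> v <= Rabs (g x) -> Rabs (g x) ^ N <= c * Rabs (f x).
Proof.
move=> hcl hbd fc gc hz hv.
have fpos x : S x -> v <= Rabs (g x) -> 0 < Rabs (f x).
  move=> Sx hx; apply: Rabs_pos_lt => h; move: hx; rewrite (hz x Sx h) Rabs_R0; lra.
have [|c hc] := @locally_bounded_compact n S
  (* Extended by 0, the quotient need not be continuous, but local boundedness suffices. *)
  (fun y => if Rle_dec v (Rabs (g y)) then Rabs (g y) ^ N / Rabs (f y) else 0) hcl hbd.
  move=> x Sx; case: (Rlt_le_dec (Rabs (g x)) v) => hx.
    have [|d [hd h]] := gc x Sx (v - Rabs (g x)); first lra.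
    exists d, 0; split=> // y Sy /(h y Sy) hy; case: (Rle_dec v (Rabs (g y))) => [hgy|hgy] /=; last lra.
    by have := Rabs_triang (g y - g x) (g x); have -> : g y - g x + g x = g y by [lra]; lra.
  have fx := fpos x Sx hx.
  have [|d1 [hd1 h1]] := fc x Sx (Rabs (f x) / 2); first lra.
  have [|d2 [hd2 h2]] := gc x Sx 1; first lra.
  exists (Rmin d1 d2), ((Rabs (g x) + 1) ^ N / (Rabs (f x) / 2)).
  split; first exact: Rmin_glb_lt.
  have p0 : 0 <= (Rabs (g x) + 1) ^ N by apply: pow_le; have := Rabs_pos (g x); lra.
  have i0 : 0 < / (Rabs (f x) / 2) by apply: Rinv_0_lt_compat; lra.
  move=> y Sy hy; case: (Rle_dec v (Rabs (g y))) => [hgy|hgy] /=; last by apply: Rmult_le_pos; lra.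
  have {}h1 : Rabs (f y - f x) < Rabs (f x) / 2.
    by apply: h1 => // i; apply: Rlt_le_trans (hy i) (Rmin_l _ _).
  have {}h2 : Rabs (g y - g x) < 1.
    by apply: h2 => // i; apply: Rlt_le_trans (hy i) (Rmin_r _ _).
  have fy := fpos y Sy hgy.
  have gle : Rabs (g y) <= Rabs (g x) + 1.
    by have := Rabs_triang (g y - g x) (g x); have -> : g y - g x + g x = g y by [lra]; lra.
  have fle : Rabs (f x) / 2 <= Rabs (f y).
    have := Rabs_triang (f x - f y) (f y); rewrite (Rabs_minus_sym (f x)).
    by have -> : f x - f y + f y = f x by [lra]; lra.
  apply: Rmult_le_compat.
  - by apply: pow_le; apply: Rabs_pos.
  - by apply: Rlt_le; apply: Rinv_0_lt_compat.
  - by apply: pow_incr; split=> //; apply: Rabs_pos.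
  - by apply: Rinv_le_contravar; lra.
exists c => x Sx hx; have := hc x Sx; case: (Rle_dec v (Rabs (g x))) => //= _ hq.
have fx := fpos x Sx hx.
have -> : Rabs (g x) ^ N = Rabs (g x) ^ N / Rabs (f x) * Rabs (f x) by field; lra.
by apply: Rmult_le_compat_r => //; lra.
Qed.

(** * Boolean combinations *)

(** Induction on [A]: inside [C a] and inside its complement, [X] agrees with a set saturated for
    the shorter list. *)
Lemma saturated_finite (P T : Type) (C : P -> T -> Prop) (A : list P) :
  exists L : list (T -> Prop), forall X, saturated C A X -> In X L.
Proof.
elim: A => [|a A [L hL]].
  exists [:: (fun _ => True); (fun _ => False)] => X hX.
  case: (classic (exists x, X x)) => [[x hx]|hn]; [left|right; left];
    apply: functional_extensionality => y; apply: propositional_extensionality; split=> //.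
  - by move=> _; apply: (hX x).
  - by move=> hy; apply: hn; exists y.
exists (List.map (fun p x => (C a x /\ p.1 x) \/ (~ C a x /\ p.2 x)) (list_prod L L)) => X hX.
pose X1 x := exists y, [/\ C a y, X y & forall b, In b A -> (C b y <-> C b x)].
pose X2 x := exists y, [/\ ~ C a y, X y & forall b, In b A -> (C b y <-> C b x)].
have h1 : In X1 L.
  apply: hL => x y h [z [hz Xz hzx]]; exists z; split=> // b hb.
  by rewrite (hzx b hb); apply: h.
have h2 : In X2 L.
  apply: hL => x y h [z [hz Xz hzx]]; exists z; split=> // b hb.
  by rewrite (hzx b hb); apply: h.
have -> : X = (fun x => (C a x /\ X1 x) \/ (~ C a x /\ X2 x)).
  apply: functional_extensionality => x; apply: propositional_extensionality; split.
    by move=> hx; case: (classic (C a x)) => ha; [left|right]; split=> //; exists x.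
  move=> [[ha [y [hy Xy h]]]|[ha [y [hy Xy h]]]]; apply: (hX y) => // b /= [<-|/h //];
    by split.
apply: (in_map (fun p x => (C a x /\ p.1 x) \/ (~ C a x /\ p.2 x)) _ (X1, X2)).
by apply/in_prod_iff.
Qed.

Lemma boolgen_saturated p n (Fam : set_ (p + n)) A' X : boolgen Fam A' X ->
  saturated (fun a y => Fam (om_concat a y)) A' X.
Proof.
move=> hX x y hxy; suff h : X x <-> X y by move/h.
elim: hX => {X} [a /hxy//|//|X _ IH|X Y _ IH1 _ IH2|X Y _ IH e].
- by rewrite IH.
- by rewrite IH1 IH2.
- by rewrite -!e.
Qed.

Lemma list_common_bound (T : Type) (P : T -> R -> Prop) (l : list T) :
  (forall x c c', c <= c' -> P x c -> P x c') ->
  (forall x, In x l -> exists c, P x c) ->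
  exists c, forall x, In x l -> P x c.
Proof.
move=> mono; elim: l => [|a l IH] h; first by exists 0.
have [c1 h1] := h a (or_introl erefl).
have [|c2 h2] := IH; first by move=> x hx; apply: h; right.
exists (Rmax c1 c2) => x /= [<-|hx]; first by apply: mono h1; apply: Rmax_l.
by apply: mono (h2 x hx); apply: Rmax_r.
Qed.

Lemma om_init_snoc n (x : pt n) t : om_init (om_snoc x t) = x.
Proof.
apply: functional_extensionality => i; rewrite /om_init /om_snoc.
case: unliftP => [j|] /(congr1 val) /=.
  by rewrite /bump leqNgt ltn_ord => /= e; congr (x _); apply: val_inj.
by move=> e; have := ltn_ord i; rewrite e ltnn.
Qed.

Lemma om_lastc_snoc n (x : pt n) t : om_lastc (om_snoc x t) = t.
Proof. by rewrite /om_lastc /om_snoc unlift_none. Qed.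

Lemma graph_snoc n (F : set_ n.+1) (f : pt n -> R) x t :
  (forall y, F y <-> om_graph f y) -> (F (om_snoc x t) <-> f x = t).
Proof. by move=> ->; rewrite /om_graph om_init_snoc om_lastc_snoc. Qed.

(** * The exponent *)

Fixpoint to_pt (n : nat) : Rn n -> pt n :=
  match n with
  | 0%N => fun _ _ => 0
  | k.+1 => fun z i => if unlift ord0 i is Some j then to_pt z.2 j else z.1
  end.

Lemma to_pt_onto n (x : pt n) : exists z, to_pt z = x.
Proof.
elim: n x => [|n IH] x; first by exists tt; apply: functional_extensionality => -[].
have [z hz] := IH (om_tailc x).
exists (x ord0, z); apply: functional_extensionality => i /=.
by rewrite hz; case: unliftP => [j|] ->.
Qed.

Lemma coord_to_pt n : coord_map (@to_pt n : Rn n -> pt_sp n).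
Proof.
elim: n => [|n [s hs]]; first by exists (fun i : 'I_0 => i) => x -[].
exists (fun i => if unlift ord0 i is Some j then rshift 1 (s j) else lshift _ ord0) => x i /=.
case: (unlift ord0 i) => [j|]; first by rewrite om_concat_r -hs.
by rewrite om_concat_l.
Qed.

Lemma coord_snoc n : coord_map ((fun z => om_snoc z.1 z.2) : prod_sp (pt_sp n) R_sp -> pt_sp n.+1).
Proof.
exists (fun i => if unlift ord_max i is Some j then lshift 1 j else rshift n ord0) => x i /=.
rewrite /om_snoc; case: (unlift ord_max i) => [j|]; first by rewrite om_concat_l.
by rewrite om_concat_r.
Qed.

Section Exponent.

Variable D : om_structure.
Hypothesis HD : is_ominimal_expansion D.
Hypothesis Hpb : polynomially_bounded D.

(** The first disjunct in the graph records the convention that the inverse of 0 is 0. *)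
Lemma DefM_inv (G : rspace) (f : G -> R) :
  DefM D (f : G -> R_sp) -> DefM D ((fun x => / f x) : G -> R_sp).
Proof.
move=> hf.
have h : Def D (fun z : prod_sp G R_sp => (f z.1 = 0 /\ z.2 = 0) \/ (f z.1 * z.2 = 1)).
  have hf' : DefM D (fun z : prod_sp G R_sp => f z.1 : R_sp).
    exact: (DefM_comp HD hf (DefM_fst HD (DefM_id HD _))).
  have h2 : DefM D (fun z : prod_sp G R_sp => z.2 : R_sp) by definable HD.
  apply: (Def_or HD).
    by apply: (Def_and HD); [apply: (Def_eq HD hf') | apply: (Def_eq HD h2)]; definable HD.
  by apply: (Def_eq HD (DefM_mul HD hf' h2)); definable HD.
apply: (Def_ext HD h) => z; split.
- move=> [[-> ->]|e]; first by rewrite Rinv_0.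
  have hz : f z.1 <> 0 by move=> e0; move: e; rewrite e0 Rmult_0_l; lra.
  by apply: (Rmult_eq_reg_l (f z.1)) => //; rewrite e Rinv_r.
- move=> <-; case: (Req_dec (f z.1) 0) => hz; [left|right]; last exact: Rinv_r.
  by rewrite hz Rinv_0.
Qed.

Lemma DefM_of_graph (G T : rspace) (K : G -> T -> Prop) :
  Def D (fun z : prod_sp G T => K z.1 z.2) ->
  (forall x, exists y, K x y) -> (forall x y y', K x y -> K x y' -> y = y') ->
  exists f : G -> T, DefM D f /\ forall x, K x (f x).
Proof.
move=> hK ex un.
pose f x := proj1_sig (constructive_indefinite_description _ (ex x)).
have hf x : K x (f x) by exact: (proj2_sig (constructive_indefinite_description _ (ex x))).
exists f; split=> //; apply: (Def_ext HD hK) => z; split; first by apply: un; apply: hf.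
by move=> <-; apply: hf.
Qed.

(** Any two definable functions of one variable are eventually comparable, so finitely many have an
    eventual maximum. *)
Lemma eventually_largest (Q : rspace) (g : prod_sp Q R_sp -> R_sp) (l : list Q) : DefM D g ->
  l <> nil -> exists q0 s0, In q0 l /\
    forall s, s0 < s -> forall q, In q l -> g (q, s) <= g (q0, s).
Proof.
move=> hg; elim: l => // a l IH _.
case: l IH => [_|b l IH].
  by exists a, 0; split; [left|move=> s _ q /= [->|[]]; lra].
have [//|q0 [s0 [hq0 hs0]]] := IH.
have hd : Def D ((fun s => g (a, s) <= g (q0, s)) : R_sp -> Prop) by definable HD.
have [s1 [hs1|hs1]] := Def_line_eventually HD hd.
- exists q0, (Rmax s0 s1); split; first by right.
  move=> s hs q /= [<-|hq]; first by apply: hs1; apply: Rle_lt_trans hs; apply: Rmax_r.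
  by apply: hs0 => //; apply: Rle_lt_trans hs; apply: Rmax_l.
- exists a, (Rmax s0 s1); split; first by left.
  move=> s hs q /= [<-|hq]; first lra.
  have := hs0 s (Rle_lt_trans _ _ _ (Rmax_l _ _) hs) q hq.
  have /Rnot_le_lt := hs1 s (Rle_lt_trans _ _ _ (Rmax_r _ _) hs).
  by move=> h1 h2; apply: Rle_trans h2 (Rlt_le _ _ h1).
Qed.

(* [h] is the running infimum of [1 / mu], where [mu] is the least positive element of
   the finite set [Z] (cut off at 1); the infimum makes it monotone. *)
Lemma least_positive_bound (Q : rspace) (Z : prod_sp (prod_sp Q R_sp) R_sp -> Prop) :
  Def D Z -> (forall q v, finite_pred (fun e => Z ((q, v), e))) ->
  exists N : nat, forall l : list Q, l <> nil -> exists t0, 0 < t0 /\ forall t w, t0 < t -> 0 < w ->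
    (forall v, 0 < v <= / t -> exists q e, [/\ In q l, Z ((q, v), e), 0 < e & e <= w]) ->
    (/ t) ^ N <= w.
Proof.
move=> hZ Zfin.
have [mu [dmu hmu]] := @DefM_of_graph (prod_sp Q R_sp) R_sp
  (fun z w => ((Z (z, w) /\ 0 < w) \/ w = 1) /\
     forall w', (Z (z, w') /\ 0 < w') \/ w' = 1 -> w <= w')
  ltac:(definable HD)
  ltac:(move=> [q v]; have [l hl] := Zfin q v;
        have [|w [hw hm]] := @list_min_sat (fun w => (Z ((q, v), w) /\ 0 < w) \/ w = 1) (1 :: l);
        [by exists 1; split; [left|right] |];
        exists w; split=> // w' hw'; apply: hm => //; case: hw' => [[/hl h _]|->]; [by right|by left])
  ltac:(move=> z y y' [h1 h2] [h3 h4]; apply: Rle_antisym; [exact: h2|exact: h4]).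
have mupos z : 0 < mu z by case: (hmu z) => [[[_ //]|->] _]; lra.
have mule z : mu z <= 1 by case: (hmu z) => _; apply; right.
(* The substitution [v = / t] turns decay of [mu] at 0 into growth of [g] at infinity. *)
pose g (z : prod_sp Q R_sp) : R_sp := / mu (z.1, / z.2).
have dg : DefM D g.
  apply: DefM_inv.
  have hi : DefM D (fun z : prod_sp Q R_sp => / z.2 : R_sp) by apply: (@DefM_inv _ (fun z : prod_sp Q R_sp => z.2)); definable HD.
  exact: (DefM_comp HD dmu (DefM_pair HD (DefM_fst HD (DefM_id HD _)) hi)).
have gge z : 1 <= g z.
  by rewrite /g -Rinv_1; apply: Rinv_le_contravar => //; apply: mupos.
have [h [dh hh]] := @DefM_of_graph (prod_sp Q R_sp) R_sp
  (fun z y => (forall s, z.2 <= s -> y <= g (z.1, s)) /\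
     forall y', (forall s, z.2 <= s -> y' <= g (z.1, s)) -> y' <= y)
  ltac:(definable HD)
  ltac:(move=> [q t] /=;
        case: (completeness (fun y => forall s, t <= s -> y <= g (q, s)));
        [by exists (g (q, t)) => y hy; apply: hy; lra
        |by exists 1 => s _; apply: gge
        |move=> y [h1 h2]; exists y; split; [|by move=> y' /h1];
         move=> s hs; apply: h2 => y' hy'; exact: hy'])
  ltac:(move=> z y y' [h1 h2] [h3 h4]; apply: Rle_antisym; [exact: h4|exact: h2]).
have [||N hN] := @uniform_growth D HD Hpb Q h dh.
- move=> th t _; have [_ h2] := hh (th, t).
  by have : 1 <= h (th, t) by [apply: h2 => s _; apply: gge]; lra.
- move=> th s t [_ le]; have [h1 _] := hh (th, s); have [_ h2] := hh (th, t).
  by apply: h2 => r /= hr; apply: h1 => /=; lra.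
exists N => l hl.
have [q0 [s0 [hq0 hs0]]] := eventually_largest dg hl.
have [t0 ht0] := hN q0.
exists (Rmax 1 (Rmax s0 t0)).
have m1 := Rmax_l 1 (Rmax s0 t0); have m2 := Rmax_r 1 (Rmax s0 t0).
have m3 := Rmax_l s0 t0; have m4 := Rmax_r s0 t0.
split; first lra.
move=> t w ht hw hv.
(* The parameter supplied by [hv] may change with [s], but [q0] dominates them all from [s0] on.
   Thus [/ w] is at most [g (q0, s)] for every [s >= t], and so at most the infimum [h (q0, t)]. *)
have h1 : / w <= h (q0, t).
  have [_ h2] := hh (q0, t); apply: h2 => s /= hs.
  have hsi : 0 < / s by apply: Rinv_0_lt_compat; lra.
  have [|q [e [hq he e0 ew]]] := hv (/ s).
    by split=> //; apply: Rinv_le_contravar; lra.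
  apply: Rle_trans (hs0 s _ q hq); last lra.
  rewrite /g /=; apply: Rinv_le_contravar; first exact: mupos.
  by have [_ hm] := hmu (q, / s); apply: Rle_trans ew; apply: hm; left.
have h2 : h (q0, t) <= t ^ N by apply: ht0; lra.
have tp : 0 < t ^ N by apply: pow_lt; lra.
rewrite pow_inv -[X in _ <= X]Rinv_inv; apply: Rinv_le_contravar; last lra.
exact: Rinv_0_lt_compat.
Qed.

Variables (n p q : nat) (FamA : set_ (p + n)) (FamB : set_ (q + n.+1)).
Hypothesis dA : D FamA.
Hypothesis dB : D FamB.

(* All the sets involved, in the variables (w, (y, x)) standing for (|f x|, g x, x),
   are put into one family, the real tag [z.1.1.1] telling them apart. *)
Definition tagged_family
  (z : prod_sp (prod_sp (prod_sp R_sp (prod_sp (pt_sp p) (pt_sp q))) R_sp) (Rn n.+2)) : Prop :=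
  (z.1.1.1 = 0 /\ FamA (om_concat z.1.1.2.1 (to_pt z.2.2.2))) \/
  (z.1.1.1 = 1 /\ FamB (om_concat z.1.1.2.2 (om_snoc (to_pt z.2.2.2) z.2.1))) \/
  (z.1.1.1 = 2 /\ FamB (om_concat z.1.1.2.2 (om_snoc (to_pt z.2.2.2) (- z.2.1)))) \/
  (z.1.1.1 = 3 /\ FamB (om_concat z.1.1.2.2 (om_snoc (to_pt z.2.2.2) z.2.2.1))) \/
  (z.1.1.1 = 4 /\ 0 < z.2.1) \/
  (z.1.1.1 = 5 /\ z.1.2 <= Rabs z.2.2.1).

Lemma Def_fam m k (Fam : set_ (m + k)) : D Fam ->
  Def D (fun z : prod_sp (pt_sp m) (pt_sp k) => Fam (om_concat z.1 z.2)).
Proof. by move=> h; apply: (D_ext HD h) => x /=; rewrite om_concat_eta. Qed.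

Lemma Def_tagged : Def D tagged_family.
Proof.
have hA := Def_fam dA; have hB := Def_fam dB.
have hp : DefM D (@to_pt n : Rn n -> pt_sp n) by apply: (DefM_coord HD); apply: coord_to_pt.
have hs := DefM_coord HD (coord_snoc n).
have HA (G : rspace) (a : G -> pt_sp p) (x : G -> Rn n) : DefM D a -> DefM D x ->
    Def D (fun z => FamA (om_concat (a z) (to_pt (x z)))).
  move=> ha hx.
  exact: (Def_preimage HD (f := fun z => (a z, to_pt (x z)) : prod_sp (pt_sp p) (pt_sp n)) hA
    (DefM_pair HD ha (DefM_comp HD hp hx))).
have HB (G : rspace) (b : G -> pt_sp q) (x : G -> Rn n) (w : G -> R_sp) :
    DefM D b -> DefM D x -> DefM D w ->
    Def D (fun z => FamB (om_concat (b z) (om_snoc (to_pt (x z)) (w z)))).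
  move=> hb hx hw.
  have h2 := DefM_comp HD hs (DefM_pair HD (DefM_comp HD hp hx) hw).
  exact: (Def_preimage HD (f := fun z => (b z, om_snoc (to_pt (x z)) (w z)) : prod_sp (pt_sp q) (pt_sp n.+1))
    hB (DefM_pair HD hb h2)).
rewrite /tagged_family.
apply: (Def_or HD); first (apply: (Def_and HD); first by definable HD).
  by apply: HA; definable HD.
do 3 (apply: (Def_or HD); first (apply: (Def_and HD); [by definable HD | by apply: HB; definable HD])).
by definable HD.
Qed.

Lemma tagged_family_cases a b v w y (x : Rn n) :
  let tag k := tagged_family (((k, (a, b)), v), (w, (y, x))) in
  [/\ tag 0 <-> FamA (om_concat a (to_pt x)),
      tag 1 <-> FamB (om_concat b (om_snoc (to_pt x) w)),
      tag 2 <-> FamB (om_concat b (om_snoc (to_pt x) (- w))),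
      tag 3 <-> FamB (om_concat b (om_snoc (to_pt x) y)) &
      (tag 4 <-> 0 < w) /\ (tag 5 <-> v <= Rabs y)].
Proof.
rewrite /tagged_family /=; split; last split;
  (split; [by move=> [[e h]|[[e h]|[[e h]|[[e h]|[[e h]|[e h]]]]]]; first [exact: h | exfalso; lra]
          |move=> h; first [by left | by right; left | by right; right; left
                    | by right; right; right; left | by right; right; right; right; left
                    | by right; right; right; right; right]]).
Qed.

(** Parameters of the tagged family, with zero points in the slots that a tag does not read. [B']
    occurs twice because [w = |f x|] means that [w] or [- w] is [f x]. *)
Definition tags (A' : list (pt p)) (B' B'' : list (pt q)) : list (R * (pt p * pt q)) :=
  (4, (fun _ => 0, fun _ => 0)) :: (5, (fun _ => 0, fun _ => 0)) ::
  List.map (fun a => (0, (a, fun _ => 0))) A' ++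
  List.map (fun b => (1, (fun _ => 0, b))) B' ++
  List.map (fun b => (2, (fun _ => 0, b))) B' ++
  List.map (fun b => (3, (fun _ => 0, b))) B''.

Lemma exponent_exists : exists N : nat, forall A' B' B'', exists v0, 0 < v0 /\
  forall (S : set_ n) (F G : set_ n.+1) (f g : pt n -> R),
    boolgen FamA A' S -> om_closed_set S -> om_bounded_set S ->
    boolgen FamB B' F -> boolgen FamB B'' G ->
    (forall y, F y <-> om_graph f y) -> (forall y, G y <-> om_graph g y) ->
    om_continuous_on f S -> om_continuous_on g S ->
    (forall x : pt n, S x -> f x = 0 -> g x = 0) ->
    forall x : pt n, S x -> 0 < Rabs (g x) < v0 -> Rabs (g x) ^ N <= Rabs (f x).
Proof.
have dC := Def_tagged.
have [||Q [sel [Z [dZ Zfin Znil hproj]]]] :=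
  @projection_locally_constant D HD (prod_sp R_sp (prod_sp (pt_sp p) (pt_sp q))) R_sp n.+1 tagged_family.
- exact: dC.
- by apply: (sampling_all HD); definable HD.
have [N hN] := least_positive_bound dZ Zfin.
exists N => A' B' B''; pose A := tags A' B' B''.
have Anil : A <> nil by [].
have [t0 [ht0 ht]] := hN (sel A) (Znil A Anil).
exists (/ t0); split; first exact: Rinv_0_lt_compat.
move=> S F G f g hS Scl Sbd hF hG Ff Gg fc gc fg x Sx [gx0 gxlt].
have fpos y : S y -> 0 < Rabs (g y) -> 0 < Rabs (f y).
  move=> Sy hy; apply: Rabs_pos_lt => h; move: hy; rewrite (fg y Sy h) Rabs_R0; lra.
(* Used with [t] the inverse of [|g x|] and [w = |f x|], so that the admissible [v] are those with
   [0 < v <= |g x|]. *)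
rewrite -[Rabs (g x)]Rinv_inv; apply: ht.
- by rewrite -[t0]Rinv_inv; apply: Rinv_lt_contravar => //; apply: Rmult_lt_0_compat => //; apply: Rinv_0_lt_compat.
- exact: fpos.
rewrite Rinv_inv => v [v0 vle].
(* Its projection to the first coordinate is the set of values of [|f|] at the points of [S] where
   [|g| >= v]. *)
pose X (z : Rn n.+2) := [/\ 0 < z.1, v <= Rabs z.2.1, S (to_pt z.2.2),
   F (om_snoc (to_pt z.2.2) z.1) \/ F (om_snoc (to_pt z.2.2) (- z.1)) &
   G (om_snoc (to_pt z.2.2) z.2.1)].
have hX : saturated (fun a z => tagged_family ((a, v), z)) A X.
  move=> [w [y z]] [w' [y' z']] hsig [/= h1 h2 h3 h4 h5].
  have sA : S (to_pt z').
    apply: (boolgen_saturated hS) h3 => a ha.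
    have hin : In (0, (a, fun _ => 0)) A.
      by right; right; apply/in_app_iff; left; apply: (in_map (fun a => (0, (a, fun _ => 0)))).
    by move: (hsig _ hin); have [-> _ _ _ _] := tagged_family_cases a (fun _ => 0) v w y z;
       have [-> _ _ _ _] := tagged_family_cases a (fun _ => 0) v w' y' z'.
  split=> //=.
  - have hin : In (4, (fun _ => 0, fun _ => 0)) A by left.
    by move: (hsig _ hin); have [_ _ _ _ [-> _]] := tagged_family_cases (fun _ => 0) (fun _ => 0) v w y z;
       have [_ _ _ _ [-> _]] := tagged_family_cases (fun _ => 0) (fun _ => 0) v w' y' z'; case=> h _; apply: h.
  - have hin : In (5, (fun _ => 0, fun _ => 0)) A by right; left.
    by move: (hsig _ hin); have [_ _ _ _ [_ ->]] := tagged_family_cases (fun _ => 0) (fun _ => 0) v w y z;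
       have [_ _ _ _ [_ ->]] := tagged_family_cases (fun _ => 0) (fun _ => 0) v w' y' z'; case=> h _; apply: h.
  - case: h4 => h4; [left|right]; apply: (boolgen_saturated hF) h4 => b hb.
    + have hin : In (1, (fun _ => 0, b)) A.
        right; right; apply/in_app_iff; right; apply/in_app_iff; left.
        exact: (in_map (fun b => (1, (fun _ => 0, b)))).
      by move: (hsig _ hin); have [_ -> _ _ _] := tagged_family_cases (fun _ => 0) b v w y z;
         have [_ -> _ _ _] := tagged_family_cases (fun _ => 0) b v w' y' z'.
    + have hin : In (2, (fun _ => 0, b)) A.
        right; right; apply/in_app_iff; right; apply/in_app_iff; right; apply/in_app_iff; left.
        exact: (in_map (fun b => (2, (fun _ => 0, b)))).
      by move: (hsig _ hin); have [_ _ -> _ _] := tagged_family_cases (fun _ => 0) b v w y z;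
         have [_ _ -> _ _] := tagged_family_cases (fun _ => 0) b v w' y' z'.
  - apply: (boolgen_saturated hG) h5 => b hb.
    have hin : In (3, (fun _ => 0, b)) A.
      right; right; do 3 (apply/in_app_iff; right).
      exact: (in_map (fun b => (3, (fun _ => 0, b)))).
    by move: (hsig _ hin); have [_ _ _ -> _] := tagged_family_cases (fun _ => 0) b v w y z;
       have [_ _ _ -> _] := tagged_family_cases (fun _ => 0) b v w' y' z'.
pose T w := exists y, X (w, y).
have Tw : T (Rabs (f x)).
  have [z hz] := to_pt_onto x.
  exists (g x, z); split=> //=; rewrite ?hz //; first exact: fpos.
  - rewrite !(graph_snoc _ _ Ff); rewrite /Rabs; case: Rcase_abs => _; [right|left]; lra.
  - by rewrite (graph_snoc _ _ Gg).
(* Exponent 0: this bounds [|f|] below by a positive number where [|g| >= v]. *)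
have [c hc] := power_bound_away 0 Scl Sbd fc gc fg v0.
have Tlow w : T w -> 1 <= c * w.
  move=> [[y z] [/= h1 h2 h3 h4 h5]].
  have ey : g (to_pt z) = y by apply/(graph_snoc _ _ Gg).
  have ew : Rabs (f (to_pt z)) = w.
    move: h4; rewrite !(graph_snoc _ _ Ff) => -[->|->]; first by rewrite Rabs_right; lra.
    by rewrite Rabs_Ropp Rabs_right; lra.
  by have := hc _ h3; rewrite ey ew /=; apply.
(* the infimum of T is positive and is a point where T is not locally constant *)
case: (completeness (fun y => T (- y))).
- exists 0 => y [y' [/= h1 _ _ _ _]]; lra.
- by exists (- Rabs (f x)); rewrite Ropp_involutive.
move=> k0 [hub hlub]; pose k := - k0.
have klow w : T w -> k <= w.
  by move=> hw; have := hub (- w); rewrite Ropp_involutive /k => /(_ hw); lra.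
have kapp d : 0 < d -> exists w, T w /\ w < k + d.
  move=> hd; apply: NNPP => hn; suff : k0 <= k0 - d by lra.
  apply: hlub => y hy; apply: Rnot_lt_le => lt; apply: hn; exists (- y); split=> //.
  by rewrite /k; lra.
(* Were [k <= 0], some [w] in [T] would be less than [/ (2 * c)], against [1 <= c * w]. *)
have kpos : 0 < k.
  have c0 : 0 < c.
    have := Tlow _ Tw; have := fpos x Sx gx0; nra.
  have [|w [hw hwk]] := kapp (/ (2 * c)).
    by apply: Rinv_0_lt_compat; lra.
  have := Tlow w hw.
  have e : c * / (2 * c) = / 2 by field; lra.
  nra.
have kle := klow _ Tw.
have [q0 [hq0 hz]] : exists q0, In q0 (sel A) /\ Z ((q0, v), k).
  apply: NNPP => hn.
  (* Outside the sets [Z], [T] would be constant near [k]; as it has points just above [k] or at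
     [k], it would also contain [k - d / 2], below its infimum. *)
  have [|d [hd hloc]] := hproj A v X Anil hX k.
    by move=> q0 hq0 hz; apply: hn; exists q0.
  have [w [hw hwd]] := kapp d hd.
  have Tk : T k by apply/(hloc w) => //; have := klow w hw; move=> ?; apply: Rabs_def1; lra.
  have : T (k - d / 2) by apply/(hloc (k - d / 2)) => //; apply: Rabs_def1; lra.
  by move/klow; lra.
by exists q0, k; split.
Qed.

End Exponent.

(** * From the exponent to a constant common to all [S], [F] and [G] *)

Theorem theorem2p16 (D : om_structure)
  (HD : is_ominimal_expansion D) (Hpb : polynomially_bounded D)
  (n p q : nat) (A : set_ p) (FamA : set_ (p + n))
  (B : set_ q) (FamB : set_ (q + n.+1))
  (HA : definable_family D A FamA) (HB : definable_family D B FamB) :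
  exists N : nat, (0 < N)%nat /\
    forall (A' : list (pt p)) (B' B'' : list (pt q)),
      (forall a, In a A' -> A a) ->
      (forall b, In b B' -> B b) ->
      (forall b, In b B'' -> B b) ->
      exists c : R,
        forall (S : set_ n) (F G : set_ n.+1) (f g : pt n -> R),
          boolgen FamA A' S -> om_closed_set S -> om_bounded_set S ->
          boolgen FamB B' F -> boolgen FamB B'' G ->
          (forall y, F y <-> om_graph f y) ->
          (forall y, G y <-> om_graph g y) ->
          om_continuous_on f S -> om_continuous_on g S ->
          (forall x : pt n, S x -> f x = 0 -> g x = 0) ->
          forall x : pt n, S x -> Rabs (g x) ^ N <= c * Rabs (f x).
Proof.
have [_ [dA _]] := HA; have [_ [dB _]] := HB.
have [N hN] := exponent_exists HD Hpb dA dB.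
(* The successor makes the exponent positive; the passage from [N] to [N.+1] uses [|g x| <= 1]. *)
exists N.+1; split=> // A' B' B'' _ _ _.
have [v0 [hv0 hbound]] := hN A' B' B''.
(* Finitely many triples [S], [F], [G] arise, so a constant for each triple gives a common one. *)
have [LS hLS] := saturated_finite (fun a y => FamA (om_concat a y)) A'.
have [LF hLF] := saturated_finite (fun b y => FamB (om_concat b y)) B'.
have [LG hLG] := saturated_finite (fun b y => FamB (om_concat b y)) B''.
pose P (SFG : set_ n * (set_ n.+1 * set_ n.+1)) c := forall f g : pt n -> R,
  boolgen FamA A' SFG.1 -> om_closed_set SFG.1 -> om_bounded_set SFG.1 ->
  boolgen FamB B' SFG.2.1 -> boolgen FamB B'' SFG.2.2 ->
  (forall y, SFG.2.1 y <-> om_graph f y) -> (forall y, SFG.2.2 y <-> om_graph g y) ->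
  om_continuous_on f SFG.1 -> om_continuous_on g SFG.1 ->
  (forall x : pt n, SFG.1 x -> f x = 0 -> g x = 0) ->
  forall x : pt n, SFG.1 x -> Rabs (g x) ^ N.+1 <= c * Rabs (f x).
have [||c hc] := @list_common_bound _ P (list_prod LS (list_prod LF LG)).
- move=> SFG c c' le h f g h1 h2 h3 h4 h5 h6 h7 h8 h9 h10 x hx.
  apply: Rle_trans (h f g h1 h2 h3 h4 h5 h6 h7 h8 h9 h10 x hx) _.
  by apply: Rmult_le_compat_r => //; apply: Rabs_pos.
- move=> [S [F G]] _; apply: NNPP => hn.
  (* F and G determine f and g, so c may be chosen after them *)
  have hn' c : exists f g : pt n -> R, [/\
      boolgen FamA A' S /\ om_closed_set S /\ om_bounded_set S,
      boolgen FamB B' F /\ boolgen FamB B'' G,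
      (forall y, F y <-> om_graph f y) /\ (forall y, G y <-> om_graph g y),
      om_continuous_on f S /\ om_continuous_on g S /\
      (forall x : pt n, S x -> f x = 0 -> g x = 0) &
      exists x, S x /\ c * Rabs (f x) < Rabs (g x) ^ N.+1].
    apply: NNPP => hc; apply: hn; exists c => f g /= h1 h2 h3 h4 h5 h6 h7 h8 h9 h10 x hx.
    apply: Rnot_lt_le => lt; apply: hc; exists f, g; split=> //; by exists x.
  (* The value 0 is arbitrary: this call only supplies the functions [f] and [g], from which the
     constant is then computed. *)
  have [f [g [[h1 [h2 h3]] [h4 h5] [h6 h7] [h8 [h9 h10]] _]]] := hn' 0.
  have v1 : 0 < Rmin v0 1 by apply: Rmin_glb_lt; lra.
  have [c hc] := power_bound_away N.+1 h2 h3 h8 h9 h10 v1.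
  have [f' [g' [_ _ [h6' h7'] _ [x [Sx hx]]]]] := hn' (Rmax c 1).
  have ef : f' x = f x by apply/(graph_snoc x (f x) h6'); apply/(graph_snoc x (f x) h6).
  have eg : g' x = g x by apply/(graph_snoc x (g x) h7'); apply/(graph_snoc x (g x) h7).
  move: hx; rewrite ef eg; apply: Rle_not_lt.
  have af := Rabs_pos (f x); have ag := Rabs_pos (g x).
  have m1 := Rmax_l c 1; have m2 := Rmax_r c 1.
  (* Compactness covers the values of [|g|] above the threshold; below it, the exponent bound holds
     with constant 1 unless [g x] is 0, where the claim is trivial. *)
  case: (Rle_lt_dec (Rmin v0 1) (Rabs (g x))) => hgx.
    by apply: Rle_trans (hc x Sx hgx) _; apply: Rmult_le_compat_r.
  case: (Req_dec (Rabs (g x)) 0) => g0; first by rewrite g0 /=; nra.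
  have hb := hbound S F G f g h1 h2 h3 h4 h5 h6 h7 h8 h9 h10 x Sx.
  have {}hb : Rabs (g x) ^ N <= Rabs (f x).
    by apply: hb; have := Rmin_l v0 1; lra.
  have gle : Rabs (g x) <= 1 by have := Rmin_r v0 1; lra.
  have := pow_le (Rabs (g x)) N ag; rewrite /=; nra.
exists c => S F G f g h1 h2 h3 h4 h5; apply: (hc (S, (F, G))) => //.
apply/in_prod_iff; split; first by apply: hLS; apply: boolgen_saturated.
by apply/in_prod_iff; split; [apply: hLF|apply: hLG]; apply: boolgen_saturated.
Qed.
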